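(* Let $v\in S_n$ be vexillary. The map $$\overline\gamma:\overline{\mathsf{FSYT}}(v)\to\mathsf{MPipes}(v),\qquad \overline\gamma(\mathbf T)=(\gamma(\mathrm{flatten}(\mathbf T)),\ \mathcal S_{\mathbf T}),$$ is a weight preserving bijection.
   Context: A permutation $v\in S_n$ is vexillary if it avoids the pattern $2143$, i.e. there are no $i_1<i_2<i_3<i_4$ with $v_{i_2}<v_{i_1}<v_{i_4}<v_{i_3}$. $\ell(v)$ is the Coxeter length. Bumpless pipe dreams. Cells $(i,j)$ of a grid: row $i$ from the top, column $j$ from the left. There are six tiles: downward elbow (a pipe joining the bottom and right edges), upward elbow (a pipe joining the left and top edges), crossing (one pipe joining left and right edges and one joining bottom and top edges), blank (no pipe), horizontal (a pipe joining left and right edges), vertical (a pipe joining bottom and top edges). A bumpless pipe dream (BPD) of size $n$ is a tiling of the $n\times n$ grid by these tiles such that an edge shared by two cells is met by a pipe from both sides or from neither, every edge on the bottom and right boundaries of the grid is met by a pipe, and no edge on the left or top boundary is met by a pipe. $D(\mathcal P)$ (resp. $U(\mathcal P)$) is the set of positions of blank (resp. upward elbow) tiles of $\mathcal P$. Demazure product $\partial(\mathcal P)\in S_n$: label the bottom boundary edges $1,\dots,n$ from left to right and propagate labels along pipes north and east; at a crossing tile, of the two labels entering from the left and from below, the smaller leaves through the right edge and the larger through the top edge. $\partial(\mathcal P)(i)$ is the label arriving at the right boundary edge of row $i$. $\mathsf{Pipes}(v)=\{\mathcal P:\partial(\mathcal P)=v\}$, and $\mathsf{MPipes}(v)$ is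 the set of pairs $(\mathcal P,\mathcal S)$ with $\mathcal P\in\mathsf{Pipes}(v)$, $\mathcal S\subseteq U(\mathcal P)$. Partitions attached to $v$. For a partition $\lambda$, $\mathbb Y(\lambda)=\{(i,j):1\le j\le\lambda_i\}$. The Rothe diagram is $D(v)=\{(i,j):v_i>j,\ v^{-1}(j)>i\}$, and the Lehmer code is $\mathsf c_v(i)=|\{j:(i,j)\in D(v)\}|$. $\mu^{(v)}$ is the partition obtained by sorting the entries of $\mathsf c_v$ into weakly decreasing order; $\lambda^{(v)}$ is the smallest partition with $D(v)\subseteq\mathbb Y(\lambda^{(v)})$, i.e. $\mathbb Y(\lambda^{(v)})=\bigcup_{(i,j)\in D(v)}[1,i]\times[1,j]$. The flag $\mathbf f^{(v)}$ is defined by letting $f^{(v)}_i$ be the maximal row index $j$ with $(j,\,j-i+\mu^{(v)}_i)\in\mathbb Y(\lambda^{(v)})$. Tableaux. A tableau of shape $\mu$ is a function $T:\mathbb Y(\mu)\to\{1,2,\dots\}$; it is semistandard if entries weakly increase along rows (left to right) and strictly increase down columns. A set-valued tableau $\mathbf T$ of shape $\mu$ assigns a nonempty finite set of positive integers to each cell; it is semistandard if every tableau obtained by choosing one entry from each cell is semistandard. It is flagged by $\mathbf f$ if every entry in row $i$ is $\le f_i$ (same for ordinary tableaux). $\mathsf{FSYT}(v)$ (resp. $\overline{\mathsf{FSYT}}(v)$) is the set of semistandard tableaux (resp. semistandard set-valued tableaux) of shape $\mu^{(v)}$ flagged by $\mathbf f^{(v)}$. $\mathrm{flatten}(\mathbf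 T)(i,j)=\min\mathbf T(i,j)$. Maps. $\gamma:\mathsf{FSYT}(v)\to\mathsf{Pipes}(v)$ sends $T$ to the unique $\mathcal P\in\mathsf{Pipes}(v)$ with $D(\mathcal P)=\{(T(i,j),\,T(i,j)+j-i):(i,j)\in\mathbb Y(\mu^{(v)})\}$. Also $\mathcal S_{\mathbf T}=\{(k,\,k-i+j): (i,j)\in\mathbb Y(\mu^{(v)}),\ k\in\mathbf T(i,j),\ k\ne\min\mathbf T(i,j)\}$. Weights, with $x_i\oplus y_j=x_i+y_j+\beta x_iy_j$: a set-valued tableau of shape $\mu$ has weight $\beta^{|\mathbf T|-|\mu|}\prod_{(i,j)\in\mathbb Y(\mu)}\prod_{k\in\mathbf T(i,j)}(x_k\oplus y_{k+j-i})$, where $|\mathbf T|=\sum_{(i,j)}|\mathbf T(i,j)|$ and $|\mu|=|\mathbb Y(\mu)|$; a marked BPD $(\mathcal P,\mathcal S)\in\mathsf{MPipes}(v)$ has weight $\beta^{|D(\mathcal P)|+|\mathcal S|-\ell(v)}\prod_{(i,j)\in D(\mathcal P)\cup\mathcal S}(x_i\oplus y_j)$. *)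

(* Defs.v *)
From HB Require Import structures.
From mathcomp Require Import all_boot all_order all_fingroup all_algebra.
From mathcomp Require Import finmap.
From mathcomp Require Import boolp classical_sets functions.

Set Implicit Arguments.
Unset Strict Implicit.
Unset Printing Implicit Defensive.

Import GRing.Theory.

(* All indices start at 0: rows and columns of grids and diagrams, pipe       *)
(* labels, tableau entries, and the variables x_0, x_1, .. and y_0, y_1, ..   *)
(* A tableau entry k : nat thus stands for the positive integer k.+1.         *)

Section Permutations.
Variables (n : nat) (v : 'S_n).

Definition vexillary : Prop :=
  ~ exists i1 i2 i3 i4 : 'I_n,
      [/\ i1 < i2, i2 < i3 & i3 < i4] /\
      [/\ v i2 < v i1, v i1 < v i4 & v i4 < v i3].

Definition coxeter_length : nat :=
  #|[set p : 'I_n * 'I_n | (p.1 < p.2) && (v p.2 < v p.1)]|.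

Definition rothe : {set 'I_n * 'I_n} :=
  [set p : 'I_n * 'I_n | (p.2 < v p.1) && (p.1 < (v^-1)%g p.2)].

Definition lehmer (i : 'I_n) : nat := #|[set j | (i, j) \in rothe]|.

(* Sorted in decreasing order, with trailing zeros. *)
Definition mu_of : seq nat := sort geq [seq lehmer i | i <- enum 'I_n].

(* The Young diagram of lambda^(v), as a union of rectangles with a corner    *)
(* in the Rothe diagram.                                                      *)
Definition in_Ylambda (i j : nat) : bool :=
  [exists p : 'I_n * 'I_n, [&& p \in rothe, i <= p.1 & j <= p.2]].

(* The last cell of row i of mu is (i, (nth 0 mu_of i).-1). The condition     *)
(* i < j + nth 0 mu_of i says that its translate in row j along the diagonal  *)
(* has a nonnegative column, so that the subtraction is not truncated.        *)
Definition flag_of (i : nat) : nat :=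
  \max_(j < n | (i < j + nth 0 mu_of i) &&
                in_Ylambda j ((j + nth 0 mu_of i).-1 - i)) j.

End Permutations.

Inductive tile : Type :=
  Blank | DownElbow | UpElbow | Crossing | Horizontal | Vertical.

Definition tile_code (t : tile) : nat :=
  match t with
  | Blank => 0 | DownElbow => 1 | UpElbow => 2
  | Crossing => 3 | Horizontal => 4 | Vertical => 5
  end.

Definition tile_decode (k : nat) : tile :=
  match k with
  | 0 => Blank | 1 => DownElbow | 2 => UpElbow
  | 3 => Crossing | 4 => Horizontal | _ => Vertical
  end.

Lemma tile_codeK : cancel tile_code tile_decode.
Proof. by case. Qed.

HB.instance Definition _ := Equality.copy tile (can_type tile_codeK).
HB.instance Definition _ := Choice.copy tile (can_type tile_codeK).

Definition meets_left (t : tile) : bool :=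
  t \in [:: UpElbow; Crossing; Horizontal].
Definition meets_right (t : tile) : bool :=
  t \in [:: DownElbow; Crossing; Horizontal].
Definition meets_top (t : tile) : bool :=
  t \in [:: UpElbow; Crossing; Vertical].
Definition meets_bottom (t : tile) : bool :=
  t \in [:: DownElbow; Crossing; Vertical].

Section BumplessPipeDreams.
Variable n : nat.
Implicit Type P : 'M[tile]_n.

Definition is_bpd P : Prop :=
  [/\ forall i j j' : 'I_n,
        j' = j.+1 :> nat -> meets_right (P i j) = meets_left (P i j'),
      forall i i' j : 'I_n,
        i' = i.+1 :> nat -> meets_bottom (P i j) = meets_top (P i' j),
      forall i j : 'I_n,
        (i.+1 = n -> meets_bottom (P i j)) /\
        (j.+1 = n -> meets_right (P i j)) &
      forall i j : 'I_n,
        (i = 0 :> nat -> ~~ meets_top (P i j)) /\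
        (j = 0 :> nat -> ~~ meets_left (P i j))].

Definition tile_positions (t : tile) P : {fset nat * nat} :=
  [fset (nat_of_ord p.1, nat_of_ord p.2)
  | p : 'I_n * 'I_n in [pred p | P p.1 p.2 == t]]%fset.

Definition blanks P := tile_positions Blank P.
Definition up_elbows P := tile_positions UpElbow P.

(* V i j is the label of the top edge of cell (i, j), so V i.+1 j labels its  *)
(* bottom edge; H i j is the label of its left edge, so H i j.+1 labels its   *)
(* right edge. Edges not met by a pipe are unconstrained.                     *)
Definition is_labelling P (V H : nat -> nat -> nat) : Prop :=
  (forall j : 'I_n, V n j = j) /\
  (forall i j : 'I_n,
     match P i j with
     | Blank => True
     | DownElbow => H i j.+1 = V i.+1 j
     | UpElbow => V i j = H i j
     | Crossing => H i j.+1 = minn (H i j) (V i.+1 j) /\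
                   V i j = maxn (H i j) (V i.+1 j)
     | Horizontal => H i j.+1 = H i j
     | Vertical => V i j = V i.+1 j
     end).

(* On a bumpless pipe dream the labels of the edges met by pipes, among them  *)
(* all edges of the right boundary, are determined by the bottom boundary.    *)
Definition demazure_product_is P (v : 'S_n) : Prop :=
  exists V H : nat -> nat -> nat,
    is_labelling P V H /\ forall i : 'I_n, H i n = v i.

Definition Pipes (v : 'S_n) : set 'M[tile]_n :=
  [set P | is_bpd P /\ demazure_product_is P v]%classic.

Definition MPipes (v : 'S_n) : set ('M[tile]_n * {fset nat * nat}) :=
  [set PS | Pipes v PS.1 /\ (PS.2 `<=` up_elbows PS.1)%fset]%classic.

End BumplessPipeDreams.

Section Tableaux.

Definition young (mu : seq nat) : {fset nat * nat} :=
  [fset c in [seq (i, j) | i <- iota 0 (size mu), j <- iota 0 (nth 0 mu i)]]%fset.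

Definition tableau (mu : seq nat) : Type := {ffun young mu -> nat}.

Definition set_tableau (mu : seq nat) : Type := {ffun young mu -> {fset nat}}.

Variable mu : seq nat.
Implicit Types (T : tableau mu) (TT : set_tableau mu) (c d : young mu).

Definition rowc c : nat := (val c).1.
Definition colc c : nat := (val c).2.

Definition semistandard T : Prop :=
  (forall c d, rowc c = rowc d -> colc c <= colc d -> T c <= T d) /\
  (forall c d, colc c = colc d -> rowc c < rowc d -> T c < T d).

Definition set_semistandard TT : Prop :=
  (forall c, TT c != fset0%fset) /\
  (forall T, (forall c, T c \in TT c) -> semistandard T).

Definition flagged (f : nat -> nat) T : Prop :=
  forall c, T c <= f (rowc c).

Definition set_flagged (f : nat -> nat) TT : Prop :=
  forall c k, k \in TT c -> k <= f (rowc c).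

Definition fset_min (A : {fset nat}) : nat := head 0 (sort leq A).

Definition flatten_tableau TT : tableau mu := [ffun c => fset_min (TT c)].

(* An entry k of row i of a semistandard tableau satisfies i <= k, so the     *)
(* column k + j - i is a true difference.                                     *)
Definition entry_pos c (k : nat) : nat * nat := (k, k + colc c - rowc c).

Definition tableau_positions T : {fset nat * nat} :=
  [fset entry_pos c (T c) | c in {: young mu}]%fset.

Definition marks TT : {fset nat * nat} :=
  [fset entry_pos c k | c in {: young mu},
                        k in (TT c `\ fset_min (TT c))]%fset.

End Tableaux.

Section Map.
Variables (n : nat) (v : 'S_n).

Definition FSYT : set (tableau (mu_of v)) :=
  [set T | semistandard T /\ flagged (flag_of v) T]%classic.

Definition set_FSYT : set (set_tableau (mu_of v)) :=
  [set TT | set_semistandard TT /\ set_flagged (flag_of v) TT]%classic.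

Definition gamma_graph (T : tableau (mu_of v)) : set 'M[tile]_n :=
  [set P | Pipes v P /\ blanks P = tableau_positions T]%classic.

(* The blank grid is a default value, used when gamma_graph T is empty.       *)
Definition gamma (T : tableau (mu_of v)) : 'M[tile]_n :=
  xget (const_mx Blank) (gamma_graph T).

Definition gamma_bar (TT : set_tableau (mu_of v)) :
    'M[tile]_n * {fset nat * nat} :=
  (gamma (flatten_tableau TT), marks TT).

End Map.

Arguments FSYT {n} v.
Arguments set_FSYT {n} v.
Arguments gamma_graph {n} v.
Arguments gamma {n} v.
Arguments gamma_bar {n} v.

Section Weights.
Local Open Scope ring_scope.
Variables (R : comNzRingType) (beta : R) (x y : nat -> R).

Definition pos_weight (p : nat * nat) : R :=
  x p.1 + y p.2 + beta * x p.1 * y p.2.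

Definition tableau_weight (mu : seq nat) (TT : set_tableau mu) : R :=
  beta ^+ (\sum_(c : young mu) #|` TT c| - #|` young mu|)%N *
  \prod_(c : young mu) \prod_(k <- TT c) pos_weight (entry_pos c k).

(* If (P, S) is in MPipes v then P has at least coxeter_length v blank tiles, *)
(* so the exponent is a true difference.                                      *)
Definition marked_bpd_weight (n : nat) (v : 'S_n)
    (PS : 'M[tile]_n * {fset nat * nat}) : R :=
  beta ^+ (#|` blanks PS.1| + #|` PS.2| - coxeter_length v)%N *
  \prod_(p <- (blanks PS.1 `|` PS.2)%fset) pos_weight p.

End Weights.

(* Main.v *)
Require Import Defs.
From mathcomp Require Import all_boot all_order all_fingroup all_algebra.
From mathcomp Require Import finmap zify.
From mathcomp Require Import boolp classical_sets functions.

(* Summing the elbow signs (+1 downward, -1 upward) over NW rectangles turns a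
   bumpless pipe dream into a rank function r on grid vertices, with steps in
   {0, 1}; a tile is blank or a crossing when r grows by 0 or 2 along its
   diagonal.  For any v, a pipe dream of v has the Rothe rank function outside
   the Young diagram of lambda.  A crossing at (i, j) creates an inversion of v
   between values at most j in positions at most i, and below such an inversion
   a cell of the Rothe diagram completes a 2143; hence a vexillary v has no
   crossings inside lambda.  These two properties characterize Pipes(v), because
   labels change their order only at crossings.
   Inside lambda, r is then determined by the blank tiles, and the blank tile
   (k, l) with rank r corresponds to the entry k in cell (k - r, l - r): the
   steps of r being in {0, 1} is semistandardness, and the shape is mu because
   #{k < p : c_v(k) > q - s} > p - s exactly when s exceeds the rank at a
   boundary vertex (p, q) of lambda.  Up elbows of rank r at (k, l) are the
   entries k that can be added to cell (k - r - 1, l - r - 1). *)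

Lemma down_ind n (Q : nat -> Prop) :
  Q n -> (forall i, i < n -> Q i.+1 -> Q i) -> forall i, i <= n -> Q i.
Proof.
move=> Qn QS i le_in; rewrite -(subKn le_in).
elim: (n - i) (leq_subr i n) => [|m IH] le_mn; first by rewrite subn0.
by apply: QS; [lia | rewrite subnSK //; apply: IH; lia].
Qed.

(** * Corner sums of bumpless pipe dreams *)

(** These are the corner sums of alternating sign matrices, indexed by grid vertices; vertex
    [(i, j)] is the top left corner of cell [(i, j)]. *)
Definition corner_sum (n : nat) (r : nat -> nat -> nat) : Prop :=
  [/\ forall p, p <= n -> [/\ r 0 p = 0, r p 0 = 0, r n p = p & r p n = p],
      forall p q, p <= n -> q < n -> r p q <= r p q.+1 <= (r p q).+1 &
      forall p q, p < n -> q <= n -> r p q <= r p.+1 q <= (r p q).+1].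

(** A pipe meets an edge exactly when [r] grows along it. Only as many edges are tested as are
    needed to name the tile of a corner sum. *)
Definition tile_at (r : nat -> nat -> nat) (i j : nat) : tile :=
  if r i j < r i j.+1 then
    if r i j < r i.+1 j then
      if r i j.+1 < r i.+1 j.+1 then Crossing else UpElbow
    else Vertical
  else if r i j < r i.+1 j then Horizontal
  else if r i j.+1 < r i.+1 j.+1 then DownElbow else Blank.

Lemma tile_blankE r i j : (tile_at r i j == Blank) =
  [&& r i j.+1 <= r i j, r i.+1 j <= r i j & r i.+1 j.+1 <= r i j.+1].
Proof.
rewrite /tile_at; case: (ltnP (r i j) (r i j.+1)) => _;
  case: (ltnP (r i j) (r i.+1 j)) => _;
  by case: (ltnP (r i j.+1) (r i.+1 j.+1)).
Qed.

Lemma tile_upE r i j : (tile_at r i j == UpElbow) =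
  [&& r i j < r i j.+1, r i j < r i.+1 j & r i.+1 j.+1 <= r i j.+1].
Proof.
rewrite /tile_at; case: (ltnP (r i j) (r i j.+1)) => _;
  case: (ltnP (r i j) (r i.+1 j)) => _;
  by case: (ltnP (r i j.+1) (r i.+1 j.+1)).
Qed.

Definition corner_mx (n : nat) (r : nat -> nat -> nat) : 'M[tile]_n :=
  (\matrix_(i, j) tile_at r i j)%R.

Variant tile_spec (r : nat -> nat -> nat) (i j : nat) : tile -> Prop :=
| TileBlank of r i j.+1 = r i j & r i.+1 j = r i j & r i.+1 j.+1 = r i j :
    tile_spec r i j Blank
| TileDown of r i j.+1 = r i j & r i.+1 j = r i j & r i.+1 j.+1 = (r i j).+1 :
    tile_spec r i j DownElbow
| TileUp of r i j.+1 = (r i j).+1 & r i.+1 j = (r i j).+1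
    & r i.+1 j.+1 = (r i j).+1 : tile_spec r i j UpElbow
| TileCross of r i j.+1 = (r i j).+1 & r i.+1 j = (r i j).+1
    & r i.+1 j.+1 = (r i j).+2 : tile_spec r i j Crossing
| TileHor of r i j.+1 = r i j & r i.+1 j = (r i j).+1
    & r i.+1 j.+1 = (r i j).+1 : tile_spec r i j Horizontal
| TileVer of r i j.+1 = (r i j).+1 & r i.+1 j = r i j
    & r i.+1 j.+1 = (r i j).+1 : tile_spec r i j Vertical.

Lemma tileP n r i j : corner_sum n r -> i < n -> j < n ->
  tile_spec r i j (tile_at r i j).
Proof.
move=> [_ hh hv] lt_in lt_jn; rewrite /tile_at.
have := hh i j (ltnW lt_in) lt_jn; have := hh i.+1 j lt_in lt_jn.
have := hv i j lt_in (ltnW lt_jn); have := hv i j.+1 lt_in lt_jn.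
by do ![case: ifP] => *; constructor; lia.
Qed.

Lemma corner_mx_bpd n r : corner_sum n r -> is_bpd (corner_mx n r).
Proof.
move=> cr; have [hb _ _] := cr; split=> i j.
- move=> j' e; rewrite !mxE e.
  have := ltn_ord j'; rewrite e => lt_j.
  by case: (tileP _ _ _ _ cr (ltn_ord i) (ltn_ord j)) => *;
     case: (tileP _ _ _ _ cr (ltn_ord i) lt_j) => *; rewrite // ?inE //; lia.
- move=> j' e; rewrite !mxE e.
  have := ltn_ord j; rewrite e => lt_j.
  by case: (tileP _ _ _ _ cr (ltn_ord i) (ltn_ord j')) => *;
     case: (tileP _ _ _ _ cr lt_j (ltn_ord j')) => *; rewrite // ?inE //; lia.
- have [_ _ nj _] := hb j (ltnW (ltn_ord j)).
  have [_ _ nj1 _] := hb j.+1 (ltn_ord j).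
  have [_ _ _ in1] := hb i (ltnW (ltn_ord i)).
  have [_ _ _ in2] := hb i.+1 (ltn_ord i).
  split=> e; rewrite !mxE.
    have e1 : r n j = r i.+1 j by rewrite e.
    have e2 : r n j.+1 = r i.+1 j.+1 by rewrite e.
    by case: (tileP _ _ _ _ cr (ltn_ord i) (ltn_ord j)) => *;
      rewrite // ?inE //; lia.
  have e1 : r i n = r i j.+1 by rewrite e.
  have e2 : r i.+1 n = r i.+1 j.+1 by rewrite e.
  by case: (tileP _ _ _ _ cr (ltn_ord i) (ltn_ord j)) => *;
    rewrite // ?inE //; lia.
- have [j0 _ _ _] := hb j (ltnW (ltn_ord j)).
  have [j1 _ _ _] := hb j.+1 (ltn_ord j).
  have [_ i0 _ _] := hb i (ltnW (ltn_ord i)).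
  have [_ i1 _ _] := hb i.+1 (ltn_ord i).
  split=> e; rewrite !mxE;
    case: (tileP _ _ _ _ cr (ltn_ord i) (ltn_ord j));
    rewrite e => *; rewrite // ?inE //; lia.
Qed.

Lemma count_iotaS (Q : pred nat) q :
  count Q (iota 0 q.+1) = count Q (iota 0 q) + Q q.
Proof. by rewrite -addn1 iotaD count_cat /= addn0. Qed.

(** The witness [r p q] counts the pipes through the first [q] edges of the horizontal grid line
    [p]. *)
Lemma bpd_corner n (P : 'M[tile]_n) :
  is_bpd P -> exists2 r, corner_sum n r & P = corner_mx n r.
Proof.
case=> hR hB hbr htl.
pose t p q : tile := if insub p is Some i then if insub q is Some j then P i
  j else Blank else Blank.
have tE (i j : 'I_n) : t i j = P i j by rewrite /t !valK.
(* A bottom boundary edge is the top of no cell but is always met by a pipe, whence the disjunct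
   [p == n]. *)
pose uV (p j : nat) := (p == n) || meets_top (t p j).
pose uH (i q : nat) := (q == n) || meets_left (t i q).
have uV1 i j : i < n -> j < n -> uV i.+1 j = meets_bottom (t i j).
  move=> hi hj; rewrite /uV; case: eqP => [e|/eqP ne] /=.
    by have [h _] := hbr (Ordinal hi) (Ordinal hj);
      rewrite (tE (Ordinal hi) (Ordinal hj)) h.
  have hi1 : i.+1 < n by rewrite ltn_neqAle ne.
  by rewrite (tE (Ordinal hi1) (Ordinal hj)) (tE (Ordinal hi) (Ordinal hj))
             (hB _ (Ordinal hi1)).
have uH1 i j : i < n -> j < n -> uH i j.+1 = meets_right (t i j).
  move=> hi hj; rewrite /uH; case: eqP => [e|/eqP ne] /=.
    by have [_ h] := hbr (Ordinal hi) (Ordinal hj);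
      rewrite (tE (Ordinal hi) (Ordinal hj)) h.
  have hj1 : j.+1 < n by rewrite ltn_neqAle ne.
  by rewrite (tE (Ordinal hi) (Ordinal hj1)) (tE (Ordinal hi) (Ordinal hj))
             (hR _ _ (Ordinal hj1)).
have uV0 i j : i < n -> uV i j = meets_top (t i j) by move=> hi;
  rewrite /uV ltn_eqF.
have uH0 i j : j < n -> uH i j = meets_left (t i j) by move=> hj;
  rewrite /uH ltn_eqF.
pose r (p q : nat) := count (uV p) (iota 0 q).
have rS p q : r p q.+1 = r p q + uV p q by rewrite /r count_iotaS.
(* Pipes are conserved at each tile: it meets as many of its left and bottom edges as of its top and
   right edges. *)
have rV i q : i < n -> q <= n -> r i.+1 q = r i q + uH i q.
  move=> hi; elim: q => [|q IH] hq.
    have hn : 0 < n by lia.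
    rewrite uH0 //= (tE (Ordinal hi) (Ordinal hn)).
    by have [_ /(_ erefl)/negbTE->] := htl (Ordinal hi) (Ordinal hn).
  rewrite !rS IH ?(ltnW hq) // uV1 // uH1 // uV0 // uH0 //.
  by case: (t i q) => /=; lia.
have r0 q : q <= n -> r 0 q = 0.
  elim: q => [//|q IH] hq; rewrite rS IH ?(ltnW hq) //.
  have hn : 0 < n by lia.
  rewrite uV0 // (tE (Ordinal hn) (Ordinal hq)).
  by have [/(_ erefl)/negbTE-> _] := htl (Ordinal hn) (Ordinal hq).
exists r.
  split=> [p hp|p q hp hq|p q hp hq]; last 2 first.
  - by rewrite rS; case: (uV p q); lia.
  - by rewrite rV //; case: (uH p q); lia.
  split=> //; first exact: r0.
    by rewrite /r (@eq_count _ _ xpredT) ?count_predT ?size_iota // => j;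
      rewrite /uV eqxx.
  elim: p hp => [|p IH] hp; first exact: r0.
  by rewrite rV // IH ?(ltnW hp) // /uH eqxx addn1.
apply/matrixP=> i j; rewrite mxE /tile_at.
have [hi hj] := (ltn_ord i, ltn_ord j).
have -> : r i.+1 j.+1 = r i j + uH i j + uV i.+1 j by rewrite rS rV // ltnW.
rewrite rS rV ?(ltnW hj) // uV0 // uV1 // uH0 // tE.
by case: (P i j); rewrite /= ?addn0 ?ltnn ?ltn_add2l ?addn1 ?ltnSn.
Qed.

(** * Labellings *)

(** Extending by the identity gives a bijection of [nat], so that cancellation needs no range
    condition. *)
Definition perm_nat {n} (s : 'S_n) (i : nat) : nat :=
  if insub i is Some i' then val (s i') else i.

Lemma perm_nat_ord n (s : 'S_n) (i : 'I_n) : perm_nat s i = s i.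
Proof. by rewrite /perm_nat valK. Qed.

Lemma perm_nat_lt n (s : 'S_n) i : (perm_nat s i < n) = (i < n).
Proof. by rewrite /perm_nat; case: insubP => [j /= -> _|/negbTE];
  rewrite ?ltn_ord. Qed.

Lemma perm_nat_id n (s : 'S_n) i : n <= i -> perm_nat s i = i.
Proof. by move=> le_ni; rewrite /perm_nat insubF // ltnNge le_ni. Qed.

Lemma perm_natK n (s : 'S_n) : cancel (perm_nat s) (perm_nat s^-1).
Proof.
move=> i; have [lt_in|ge_in] := ltnP i n.
  by rewrite (perm_nat_ord _ s (Ordinal lt_in)) perm_nat_ord permK.
by rewrite !perm_nat_id.
Qed.

Lemma perm_natKV n (s : 'S_n) : cancel (perm_nat s^-1) (perm_nat s).
Proof. by move=> i; rewrite -{1}(invgK s) perm_natK. Qed.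

Definition labelling (n : nat) (r V H : nat -> nat -> nat) : Prop :=
  (forall j, j < n -> V n j = j) /\
  (forall i j, i < n -> j < n ->
     match tile_at r i j with
     | Blank => True
     | DownElbow => H i j.+1 = V i.+1 j
     | UpElbow => V i j = H i j
     | Crossing => H i j.+1 = minn (H i j) (V i.+1 j) /\
                   V i j = maxn (H i j) (V i.+1 j)
     | Horizontal => H i j.+1 = H i j
     | Vertical => V i j = V i.+1 j
     end).

Lemma labelling_corner_mx n r V H :
  is_labelling (corner_mx n r) V H <-> labelling n r V H.
Proof.
split=> [] [hV ht].
  split=> [j hj|i j hi hj]; first exact: (hV (Ordinal hj)).
  by have := ht (Ordinal hi) (Ordinal hj); rewrite mxE.
by split=> [j|i j]; [exact: hV | rewrite mxE; exact: ht].
Qed.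

Fixpoint row_labels (r V : nat -> nat -> nat) (i q : nat) : nat :=
  if q is q'.+1 then
    match tile_at r i q' with
    | DownElbow => V i.+1 q'
    | Crossing => minn (row_labels r V i q') (V i.+1 q')
    | _ => row_labels r V i q'
    end
  (* A placeholder: in a corner sum the left boundary edges carry no pipe. *)
  else 0.

(** Labels are computed from the bottom row upwards and from left to right in each row; [W k] holds
    the labels on the grid line [n - k]. *)
Lemma labelling_exists n r : exists V H, labelling n r V H.
Proof.
pose step i (W : nat -> nat) j := let h := row_labels r (fun _ => W) i j in
  match tile_at r i j with
  | UpElbow => h | Crossing => maxn h (W j) | _ => W j end.
pose fix W k : nat -> nat := if k is k'.+1 then step (n - k) (W k') else id.
exists (fun p => W (n - p)), (fun i q => row_labels r (fun _ =>
  W (n - i.+1)) i q).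
split=> [j _|i j hi hj]; first by rewrite subnn.
have -> : n - i = (n - i.+1).+1 by lia.
have e : n - (n - i.+1).+1 = i by lia.
by case E: (tile_at r i j) => //=; rewrite /step ?e E.
Qed.

Section Labels.
Variables (n : nat) (r V H : nat -> nat -> nat).
Hypotheses (cr : corner_sum n r) (lab : labelling n r V H).

(** Labels are starting columns and pipes only run north and east; both labels entering a crossing
    in column [j] are at most [j]. *)
Lemma label_col i : i <= n ->
  (forall j, j < n -> r i j < r i j.+1 -> V i j <= j) /\
  (i < n -> forall q, q <= n -> r i q < r i.+1 q -> H i q < q).
Proof.
have [bd _ _] := cr; have [hV ht] := lab.
move: i; apply: down_ind => [|i hi [IH _]].
  by split=> [j hj _|]; [rewrite hV | rewrite ltnn].
have hH q : q <= n -> r i q < r i.+1 q -> H i q < q.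
  elim: q => [|q IHq] hq.
    by have [_ -> _ _] := bd i (ltnW hi); have [_ -> _ _] := bd _ hi.
  have := IHq (ltnW hq); have := IH q hq; have := ht i q hi hq.
  by case: (tileP _ _ _ _ cr hi hq); lia.
split=> // j hj; have := hH j (ltnW hj); have := IH j hj; have := ht i j hi hj.
by case: (tileP _ _ _ _ cr hi hj); lia.
Qed.

End Labels.

(** * The Rothe pipe dream of a permutation *)

Definition rothe_rank {n} (v : 'S_n) p q :=
  count (fun j => perm_nat v^-1 j < p) (iota 0 q).

Lemma rothe_rankS n (v : 'S_n) p q :
  rothe_rank v p q.+1 = rothe_rank v p q + (perm_nat v^-1 q < p).
Proof. exact: count_iotaS. Qed.

Lemma rothe_rankSl n (v : 'S_n) p q :
  rothe_rank v p.+1 q = rothe_rank v p q + (perm_nat v p < q).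
Proof.
elim: q => [|q IH]; first by rewrite /rothe_rank ltn0.
rewrite !rothe_rankS IH.
have : (perm_nat v p == q) = (perm_nat v^-1 q == p).
  by rewrite (can2_eq (perm_natK _ v) (perm_natKV _ v)) eq_sym.
lia.
Qed.

Lemma rothe_corner n (v : 'S_n) : corner_sum n (rothe_rank v).
Proof.
have r0 q : rothe_rank v 0 q = 0 by elim: q => // q IH; rewrite rothe_rankS IH.
have rn q : q <= n -> rothe_rank v n q = q.
  elim: q => [//|q IH] hq; rewrite rothe_rankS (IH (ltnW hq)) (perm_nat_lt n
    v^-1).
  by rewrite hq addn1.
have rn' p : p <= n -> rothe_rank v p n = p.
  elim: p => [|p IH] hp; first exact: r0.
  by rewrite rothe_rankSl (IH (ltnW hp)) (perm_nat_lt n v) hp addn1.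
split=> [p hp|p q _ _|p q _ _]; first by split; auto.
  by rewrite rothe_rankS; case: (_ < p); lia.
by rewrite rothe_rankSl; case: (_ < q); lia.
Qed.

(** The pipe starting in column [j] goes straight up to row [v^-1 j], turns once and then runs
    right; there are no up elbows. *)
Lemma rothe_labelling n (v : 'S_n) :
  labelling n (rothe_rank v) (fun _ j => j) (fun i _ => perm_nat v i).
Proof.
split=> // i j hi hj.
have := rothe_rankS n v i j; have := rothe_rankSl n v i j.
have := rothe_rankSl n v i j.+1.
by case: (tileP _ _ _ _ (rothe_corner n v) hi hj) => //; lia.
Qed.

Definition in_rothe {n} (v : 'S_n) p q := (q < perm_nat v p) && (p < perm_nat
  v^-1 q).

Lemma in_rothe_lt n (v : 'S_n) p q : in_rothe v p q -> (p < n) && (q < n).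
Proof.
rewrite /in_rothe => /andP[].
have := perm_nat_lt n v p; have := perm_nat_lt n v^-1 q.
have := perm_nat_id n v p; have := perm_nat_id n v^-1 q.
by move: (perm_nat v p) (perm_nat v^-1 q); lia.
Qed.

Section Exit.
Variables (n : nat) (v : 'S_n) (r V H : nat -> nat -> nat).
Hypotheses (cr : corner_sum n r) (lab : labelling n r V H).
Hypothesis exit : forall i, i < n -> H i n = perm_nat v i.

Let vn := perm_nat v.
Let pn := perm_nat v^-1.
Let vnK : cancel vn pn := perm_natK n v.
Let pnK : cancel pn vn := perm_natKV n v.

(** Occupied edges and labels are reconstructed north-westwards from the bottom and right
    boundaries. The bottom and right edges of a cell leave the tile open only if no pipe meets them
    (blank or up elbow), which happens only at cells of the Rothe diagram; if both are met, the
    labels tell an elbow from a crossing. *)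
Lemma frozen_outside p q : (forall i j, p <= i -> q <= j -> ~~ in_rothe v i
  j) ->
  q <= n -> p <= n -> r p q = rothe_rank v p q.
Proof.
move=> noD hq hp; have [bd hh _] := cr; have [hV ht] := lab.
have lc i : i <= n -> _ := label_col _ _ _ _ cr lab i.
suff frozen i : i <= n -> p <= i -> forall j, j < n -> q <= j ->
    (r i j < r i j.+1) = (pn j < i) /\ (r i j < r i j.+1 -> V i j = j).
  have [cbd _ _] := rothe_corner n v.
  move: q hq {noD} frozen; apply: down_ind => [|q hq IH] frozen.
    by have [_ _ _ ->] := bd p hp; have [_ _ _ ->] := cbd p hp.
  have [e _] := frozen p hp (leqnn p) q hq (leqnn q).
  have {}IH : r p q.+1 = rothe_rank v p q.+1.
    by apply: IH => i hi hpi j hj hqj; apply: frozen => //; apply: ltnW.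
  by have := hh p q hp hq; move: IH e; rewrite rothe_rankS /pn; lia.
move: i; apply: down_ind => [_|i hi IH hpi] j hj hqj.
  have [_ _ -> _] := bd j (ltnW hj); have [_ _ -> _] := bd _ hj.
  by rewrite ltnSn /pn perm_nat_lt hj; split=> // _; apply: hV.
have {}IH := IH (leqW hpi).
have hHq : forall k, k <= n -> q <= k ->
   (r i k < r i.+1 k) = (vn i < k) /\ (vn i < k -> H i k = vn i).
  apply: down_ind => [_|k hk IHk hqk].
    have [_ _ _ ->] := bd i (ltnW hi); have [_ _ _ ->] := bd _ hi.
    by rewrite ltnSn /vn perm_nat_lt hi; split=> // _; apply: exit.
  have [e1 e2] := IHk (leqW hqk); have [e3 e4] := IH k hk hqk.
  have := noD i k hpi hqk; rewrite /in_rothe -/vn -/pn.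
  have pvn : (vn i == k) = (pn k == i).
    by rewrite (can2_eq vnK pnK) eq_sym.
  (* The bound on [H i k] excludes a crossing when [vn i = k]. *)
  have [_ /(_ hi k (ltnW hk))] := lc i (ltnW hi).
  move: (ht i k hi hk) e1 e2 e3 e4 pvn.
  move: (vn i) (pn k) (H i k) (H i k.+1) (V i k) (V i.+1 k) => a b h h1 w w1.
  case: (tileP _ _ _ _ cr hi hk) => -> -> ->; rewrite ?ltnn ?ltnSn => *; lia.
have [e1 e2] := hHq j (ltnW hj) hqj; have [e3 e4] := hHq _ hj (leqW hqj).
have [e5 e6] := IH j hj hqj.
have := noD i j hpi hqj; rewrite /in_rothe -/vn -/pn.
have pvn : (vn i == j) = (pn j == i).
  by rewrite (can2_eq vnK pnK) eq_sym.
move: (ht i j hi hj) e1 e2 e3 e4 e5 e6 pvn.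
move: (vn i) (pn j) (H i j) (H i j.+1) (V i j) (V i.+1 j) => a b h h1 w w1.
case: (tileP _ _ _ _ cr hi hj) => -> -> ->; rewrite ?ltnn ?ltnSn; clear; lia.
Qed.

End Exit.

(** * Cut words and crossings *)

(** The action of a 0-Hecke generator on words. *)
Definition bump (k : nat) (s : seq nat) : seq nat :=
  let x := nth 0 s k in let y := nth 0 s k.+1 in
  take k s ++ [:: maxn x y, minn x y & drop k.+2 s].

Lemma bump_cat s x y t :
  bump (size s) (s ++ [:: x, y & t]) = s ++ [:: maxn x y, minn x y & t].
Proof.
rewrite /bump take_size_cat // !nth_cat ltnn subnn ltnNge leqnSn /= subSnn /=.
by rewrite drop_cat ltnNge -addn2 leq_addr /= addKn /= drop0.
Qed.

Section CutWords.
Variables (n : nat) (r V H : nat -> nat -> nat).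

Definition state (p : nat) : seq nat :=
  [seq V p j | j <- iota 0 n & r p j < r p j.+1].

(* The labels met by a path from the left to the right boundary: along the
   tops of the first q cells of row i, down the left edge of cell (i, q), then
   along the bottoms of the remaining cells of row i. *)
Definition cut_word (i q : nat) : seq nat :=
  [seq V i j | j <- iota 0 q & r i j < r i j.+1] ++
  nseq (r i q < r i.+1 q) (H i q) ++
  [seq V i.+1 j | j <- iota q (n - q) & r i.+1 j < r i.+1 j.+1].

Definition crossing_at (i q : nat) : bool := r i.+1 q.+1 == (r i q).+2.

Hypotheses (cr : corner_sum n r) (lab : labelling n r V H).

Lemma state_bottom : state n = iota 0 n.
Proof.
have [bd _ _] := cr; have [hV _] := lab.
rewrite /state (@eq_in_filter _ _ xpredT) ?filter_predT; last first.
  move=> j; rewrite mem_iota => hj.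
  have [_ _ -> _] := bd j (ltnW hj); have [_ _ -> _] := bd j.+1 hj.
  by rewrite ltnSn.
suff -> : [seq V n j | j <- iota 0 n] = [seq id j | j <- iota 0 n].
  by rewrite map_id.
by apply/eq_in_map => j; rewrite mem_iota => hj; apply: hV.
Qed.

Lemma cut_word0 i : i < n -> cut_word i 0 = state i.+1.
Proof.
move=> hi; have [bd _ _] := cr; rewrite /cut_word subn0.
by have [_ -> _ _] := bd i (ltnW hi); have [_ -> _ _] := bd _ hi.
Qed.

(** The last letter leaves through the right boundary of row [i]; the remaining ones begin the row
    above. *)
Lemma cut_word_last i : i < n -> cut_word i n = rcons (state i) (H i n).
Proof.
move=> hi; have [bd _ _] := cr; rewrite /cut_word subnn /=.
by have [_ _ _ ->] := bd i (ltnW hi); have [_ _ _ ->] := bd _ hi;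
  rewrite ltnSn cats1.
Qed.

Lemma size_cut_prefix i q : i <= n -> q <= n ->
  size [seq V i j | j <- iota 0 q & r i j < r i j.+1] = r i q.
Proof.
move=> hi; have [bd hh _] := cr; rewrite size_map size_filter.
elim: q => [|q IH] hq; first by have [_ -> _ _] := bd i hi.
by rewrite count_iotaS (IH (ltnW hq)); have := hh i q hi hq; lia.
Qed.

(** A tile other than a crossing carries at most one pipe and hands its label over unchanged. A
    crossing acts at index [r i q] because that many pipes meet the path before the cell. *)
Lemma cut_wordS i q : i < n -> q < n ->
  cut_word i q.+1 =
  if crossing_at i q then bump (r i q) (cut_word i q) else cut_word i q.
Proof.
move=> hi hq; have [_ ht] := lab; have {ht} := ht i q hi hq.
rewrite -(size_cut_prefix i q (ltnW hi) (ltnW hq)) /cut_word /crossing_at.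
have -> : n - q = (n - q.+1).+1 by lia.
rewrite -[in iota 0 q.+1](addn1 q) iotaD filter_cat map_cat -catA add0n /=.
move: [seq V i j | j <- _ & _] [seq j <- iota q.+1 _ | _] => s t.
case: (tileP _ _ _ _ cr hi hq) => -> -> ->; rewrite ?eqxx ?ltnn ?ltnSn
  ?ltn_eqF //=.
- by move=> ->.
- by move=> ->.
- by case=> -> ->; rewrite bump_cat.
- by move=> ->.
- by move=> ->.
Qed.

End CutWords.

Section Crossings.
Variables (n : nat) (v : 'S_n) (r V H : nat -> nat -> nat).
Hypotheses (cr : corner_sum n r) (lab : labelling n r V H).
Hypothesis exit : forall i, i < n -> H i n = perm_nat v i.

Let vn := perm_nat v.
Let pn := perm_nat v^-1.
Let vnK : forall i, pn (vn i) = i := perm_natK n v.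
Let w := cut_word n r V H.

Lemma crossing_cut i q : i < n -> q < n -> crossing_at r i q ->
  exists s x y t, [/\ size s = r i q, w i q = s ++ [:: x, y & t],
    w i q.+1 = s ++ [:: maxn x y, minn x y & t] & V i q = maxn x y].
Proof.
move=> hi hq cross.
have [_ ht] := lab; move: (ht i q hi hq) cross.
exists [seq V i j | j <- iota 0 q & r i j < r i j.+1], (H i q), (V i.+1 q),
  [seq V i.+1 j | j <- iota q.+1 (n - q.+1) & r i.+1 j < r i.+1 j.+1].
have e : size [seq V i j | j <- iota 0 q & r i j < r i j.+1] = r i q.
  by apply: (size_cut_prefix n r V cr); apply: ltnW.
have e2 : w i q = [seq V i j | j <- iota 0 q & r i j < r i j.+1] ++
   [:: H i q, V i.+1 q & [seq V i.+1 j | j <- iota q.+1 (n - q.+1) & r i.+1 j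
     < r i.+1 j.+1]].
  move: cross; rewrite /w /cut_word /crossing_at.
  have -> : n - q = (n - q.+1).+1 by lia.
  by rewrite /=; case: (tileP _ _ _ _ cr hi hq) => _ -> ->;
    rewrite ?eqxx ?ltnn ?ltnSn ?ltn_eqF //=.
split=> //; first by rewrite /w (cut_wordS _ _ _ _ cr lab) // cross -/w e2 -e
  bump_cat.
move: (ht i q hi hq) cross; rewrite /crossing_at.
by case: (tileP _ _ _ _ cr hi hq) => _ _ ->; lia.
Qed.

Lemma cut_ind (Q : nat -> nat -> Prop) :
  (forall i, i < n -> (i.+1 < n -> Q i.+1 n) -> Q i 0) ->
  (forall i q, i < n -> q < n -> Q i q -> Q i q.+1) ->
  forall i q, i < n -> q <= n -> Q i q.
Proof.
move=> Q0 QS i q hi hq.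
suff {q hq}: i <= n -> i < n -> forall q, q <= n -> Q i q by move=> h;
  apply: h => //; apply: ltnW.
move=> le_in; move: i le_in {hi}; apply: down_ind => [|i _ IH hi];
  first by rewrite ltnn.
elim=> [|q IHq] hq; last by apply: QS => //; apply: IHq; apply: ltnW.
by apply: Q0 => // hi1; apply: IH.
Qed.

Lemma uniq_cut_word i q : i < n -> q <= n -> uniq (w i q).
Proof.
move: i q; apply: cut_ind => [i hi IH|i q hi hq].
  rewrite /w (cut_word0 _ _ _ _ cr) //.
  have [e|ne] := eqVneq i.+1 n.
    by rewrite e (state_bottom _ _ _ _ cr lab) iota_uniq.
  have hi1 : i.+1 < n by rewrite ltn_neqAle ne.
  by have := IH hi1; rewrite /w (cut_word_last _ _ _ _ cr) // rcons_uniq =>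
    /andP[].
case E: (crossing_at r i q); last by rewrite /w (cut_wordS _ _ _ _ cr lab) // E.
have [s [x [y [t [_ -> -> _]]]]] := crossing_cut i q hi hq E.
rewrite !cat_uniq /= !inE !negb_or /maxn /minn; case: ifP => _ //.
by rewrite eq_sym; do ![case: (_ \in _) => //=]; rewrite ?andbF ?andbT.
Qed.

(** The induction runs backwards, from the top row down and from right to left. Undoing a crossing
    creates no new pair of a larger letter before a smaller one, and the letter appended in row [i]
    is [v i], whose position exceeds those of all letters coming from above. *)
Lemma cut_word_positions i q : i < n -> q <= n ->
  all (fun a => pn a <= i) (w i q) &&
  pairwise (fun b a => (a < b) ==> (pn b < pn a)) (w i q).
Proof.
have step : forall i, i < n -> all (fun a => pn a <= i) (w i n) &&
  pairwise (fun b a => (a < b) ==> (pn b < pn a)) (w i n) ->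
  forall q, q <= n -> all (fun a => pn a <= i) (w i q) &&
  pairwise (fun b a => (a < b) ==> (pn b < pn a)) (w i q).
  move=> {}i hi hn; apply: down_ind => // {}q hq.
  case E: (crossing_at r i q); last by rewrite {1 2}/w (cut_wordS _ _ _ _ cr
    lab) // E.
  have [s [x [y [t [_ -> -> _]]]]] := crossing_cut i q hi hq E.
  rewrite !all_cat /= !pairwise_cat /= !allrel_consr /=.
  rewrite /maxn /minn; case: ltnP => // lt_xy.
  have -> : (y < x) = false by apply/negbTE; rewrite -leqNgt ltnW.
  rewrite /= => /andP[/and4P[-> -> -> ->]] /and5P[/and3P[-> -> ->]].
  by move=> -> /andP[_ ->] -> ->.
elim: i => [|i IH] in q *; move=> hi hq; apply: step => //.
  rewrite /w (cut_word_last _ _ _ _ cr) // exit //.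
  have [bd _ _] := cr.
  have -> : state n r V 0 = [::].
    rewrite /state (@eq_in_filter _ _ pred0) ?filter_pred0 // => j.
    rewrite mem_iota => hj.
    by have [-> _ _ _] := bd j (ltnW hj); have [-> _ _ _] := bd j.+1 hj.
  by rewrite /= vnK leqnn.
have := IH 0 (ltnW hi) (leq0n n).
rewrite /w (cut_word_last _ _ _ _ cr) // exit // (cut_word0 _ _ _ _ cr)
  1?ltnW //.
rewrite all_rcons pairwise_rcons -/vn vnK leqnn /= => /andP[le_i ->].
rewrite andbT; apply/andP; split; apply: (sub_all _ le_i) => a le_ai /=.
  exact: leqW.
by rewrite ltnS le_ai implybT.
Qed.

(** Just after the crossing the larger label precedes the smaller one in the cut word, so
    [cut_word_positions] orders their positions; the larger label is the one on the top edge, which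
    [label_col] bounds by [j]. *)
Lemma crossing_inversion i j : i < n -> j < n -> crossing_at r i j ->
  exists a b, [/\ a < b, b <= j, pn b < pn a & pn a <= i].
Proof.
move=> hi hj E; have [s [x [y [t [_ _ e eV]]]]] := crossing_cut i j hi hj E.
have := uniq_cut_word i j.+1 hi hj; have := cut_word_positions i j.+1 hi hj.
rewrite e !all_cat /= !pairwise_cat /= !allrel_consr cat_uniq.
case/andP=> /and4P[_ _ le_i _] /and5P[_ _ /andP[inv _] _ _].
case/and3P=> _ _ /andP[]; rewrite inE negb_or => /andP[neq _] _.
have lt : minn x y < maxn x y by move: neq; lia.
exists (minn x y), (maxn x y); split=> //; last by move: inv; rewrite lt.
rewrite -eV; have [+ _] := label_col _ _ _ _ cr lab i (ltnW hi); apply=> //.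
by move: E; rewrite /crossing_at; case: (tileP _ _ _ _ cr hi hj) => -> _ ->;
  lia.
Qed.

End Crossings.

(** * Rank functions of the pipe dreams of a vexillary permutation *)

Definition no_crossing_at (r : nat -> nat -> nat) i j := r i.+1 j.+1 <= (r i
  j).+1.

Section Vexillary.
Variables (n : nat) (v : 'S_n).
Hypothesis v_vex : vexillary v.

Lemma vexillary_nat k1 k2 k3 k4 : k1 < k2 -> k2 < k3 -> k3 < k4 -> k4 < n ->
  perm_nat v k2 < perm_nat v k1 -> perm_nat v k1 < perm_nat v k4 -> perm_nat
    v k4 < perm_nat v k3 -> False.
Proof.
move=> h12 h23 h34 h4 *; apply: v_vex.
have h3 := ltn_trans h34 h4; have h2 := ltn_trans h23 h3;
  have h1 := ltn_trans h12 h2.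
exists (Ordinal h1), (Ordinal h2), (Ordinal h3), (Ordinal h4).
by rewrite -!perm_nat_ord.
Qed.

Lemma in_YlambdaP p q : reflect (exists p' q', [/\ in_rothe v p' q', p <= p'
  & q <= q'])
  (in_Ylambda v p q).
Proof.
apply: (iffP existsP) => [[[i j] /and3P[]]|[p' [q' [D hp hq]]]].
  rewrite inE /= => D hi hj; exists i, j; split=> //.
  by rewrite /in_rothe !perm_nat_ord.
have /andP[hp' hq'] := in_rothe_lt _ _ _ _ D.
exists (Ordinal hp', Ordinal hq'); rewrite inE /= hp hq -!perm_nat_ord !andbT.
exact: D.
Qed.

Lemma in_Ylambda_le p q p' q' :
  in_Ylambda v p' q' -> p <= p' -> q <= q' -> in_Ylambda v p q.
Proof.
move=> /in_YlambdaP[a [b [D ha hb]]] hp hq; apply/in_YlambdaP; exists a, b.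
by split; rewrite // ?(leq_trans hp) ?(leq_trans hq).
Qed.

Lemma in_Ylambda_lt p q : in_Ylambda v p q -> (p < n) && (q < n).
Proof.
case/existsP=> [[i j]] /= /and3P[_ hp hq].
by rewrite (leq_ltn_trans hp) ?(leq_ltn_trans hq) /=.
Qed.

Lemma no_inversion_in_Ylambda i j a b : in_Ylambda v i j ->
  a < b -> b <= j -> perm_nat v^-1 b < perm_nat v^-1 a -> perm_nat v^-1 a <=
    i -> False.
Proof.
move=> /in_YlambdaP[i' [j' [D hi hj]]] ab bj pba pai.
have /andP[hi' hj'] := in_rothe_lt _ _ _ _ D; have /andP[D1 D2] := D.
(* These four positions carry the values [b], [a], [v i'], [j'], and [a < b < j' < v i']: a pattern
   2143. *)
have := vexillary_nat (perm_nat v^-1 b) (perm_nat v^-1 a) i' (perm_nat v^-1 j').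
rewrite !perm_natKV; apply=> //.
- rewrite ltn_neqAle (leq_trans pai hi) andbT; apply: contraTneq D1 => <-.
  rewrite perm_natKV; lia.
- by rewrite (perm_nat_lt n v^-1).
- rewrite ltn_neqAle (leq_trans bj hj) andbT; apply: contraTneq D2 => <-.
  by lia.
Qed.

(* The conditions characterize the corner sums of Pipes(v). *)
Definition good_rank (r : nat -> nat -> nat) : Prop :=
  [/\ corner_sum n r,
      forall p q, p <= n -> q <= n -> ~~ in_Ylambda v p q -> r p q =
        rothe_rank v p q &
      forall i j, in_Ylambda v i j -> no_crossing_at r i j].

Lemma labelling_good_rank r V H : corner_sum n r -> labelling n r V H ->
  (forall i, i < n -> H i n = perm_nat v i) -> good_rank r.
Proof.
move=> cr lab exit; split=> // [p q hp hq nL|i j L].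
  apply: (frozen_outside n v r V H) => // i j hi hj; apply: contra nL => D.
  by apply/in_YlambdaP; exists i, j.
have /andP[hi hj] := in_Ylambda_lt _ _ L.
have [cross|] := boolP (crossing_at r i j).
  have [a [b [ab bj pba pai]]] := crossing_inversion n v r V H cr lab exit i
    j hi hj cross.
  by case: (no_inversion_in_Ylambda i j a b).
by rewrite /crossing_at /no_crossing_at; case: (tileP _ _ _ _ cr hi hj) =>
  _ _ ->; lia.
Qed.

Lemma rothe_good : good_rank (rothe_rank v).
Proof. exact: labelling_good_rank (rothe_corner n v) (rothe_labelling n v) _.
  Qed.

(** All cut words agree with those of the Rothe pipe dream: inside lambda neither side has a
    crossing, and outside the ranks coincide, so the same bumps occur at the same indices. The exit
    labels are the last letters at the row ends. *)
Lemma good_rank_exit r V H : good_rank r -> labelling n r V H ->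
  forall i, i < n -> H i n = perm_nat v i.
Proof.
move=> [cr off nc] lab.
have [cr' off' nc'] := rothe_good; have lab' := rothe_labelling n v.
have eqw : forall i q, i < n -> q <= n ->
  cut_word n r V H i q = cut_word n (rothe_rank v) (fun _ j => j) (fun i _ =>
    perm_nat v i) i q.
  apply: (cut_ind n) => [i hi IH|i q hi hq IH].
    rewrite !(cut_word0 _ _ _ _ _) //.
    have [e|ne] := eqVneq i.+1 n.
      by rewrite e (state_bottom _ _ _ _ cr lab) (state_bottom _ _ _ _ cr'
        lab').
    have hi1 : i.+1 < n by rewrite ltn_neqAle ne.
    by have := IH hi1; rewrite !(cut_word_last _ _ _ _ _) // => /rcons_inj[].
  rewrite (cut_wordS _ _ _ _ cr lab) // (cut_wordS _ _ _ _ cr' lab') // IH.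
  have [L|nL] := boolP (in_Ylambda v i q).
    have := nc _ _ L; have := nc' _ _ L.
    by rewrite /no_crossing_at /crossing_at => h1 h2; rewrite !ltn_eqF.
  rewrite /crossing_at !off // 1?ltnW //.
  by apply: contra nL => L; apply: in_Ylambda_le L _ _.
move=> i hi; have := eqw i n hi (leqnn n).
by rewrite !(cut_word_last _ _ _ _ _) // => /rcons_inj[].
Qed.

Lemma PipesP (P : 'M[tile]_n) :
  Pipes v P <-> exists2 r, good_rank r & P = corner_mx n r.
Proof.
split=> [[/bpd_corner[r cr ->]] [V [H [/labelling_corner_mx lab exit]]]|[r gr
  ->]].
  exists r => //; apply: (labelling_good_rank r V H) => // i hi.
  by rewrite (exit (Ordinal hi)) -perm_nat_ord.
have [cr _ _] := gr; split; first exact: corner_mx_bpd.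
have [V [H lab]] := labelling_exists n r.
exists V, H; split; first exact/labelling_corner_mx.
by move=> i; rewrite (good_rank_exit r V H) // perm_nat_ord.
Qed.

End Vexillary.

(** * The shape and the flag *)

(** The count is a part of the conjugate partition; it gives access to [mu_of] without reference to
    the sorting. *)
Lemma nth_sort_geq s i j :
  (j < nth 0 (sort geq s) i) = (i < count (fun k => j < k) s).
Proof.
rewrite -(seq.permP (permEl (perm_sort geq s)) (fun k => j < k)).
have : sorted geq (sort geq s) by apply: sort_sorted => a b; apply: leq_total.
elim: (sort geq s) i => [|x t IH] i /=; first by rewrite nth_nil.
move=> xt; have {IH}IH := IH _ (path_sorted xt).
have [lt_jx|le_xj] := ltnP j x; first by case: i => [|i] //=; rewrite IH.
have t_le : all (fun y => y <= j) t.
  apply: sub_all (order_path_min _ xt) => [y /leq_trans|a b c h1 h2];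
    first exact.
  exact: leq_trans h2 h1.
have -> : count (fun k => j < k) t = 0.
  by apply/eqP; rewrite -leqn0 leqNgt -has_count -all_predC;
    apply: sub_all t_le => y /=; rewrite -leqNgt.
case: i => [|i] /=; first by rewrite ltnNge le_xj.
have [hi|hi] := ltnP i (size t); last by rewrite nth_default.
by rewrite ltnNge (allP t_le) ?mem_nth.
Qed.

Lemma count_disjoint (A B : pred nat) s :
  (forall j, j \in s -> A j -> ~~ B j) -> count A s + count B s <= size s.
Proof.
move=> dis; rewrite -(count_predC B s) addnC leq_add2l.
by elim: s dis => //= x s IH dis; apply: leq_add;
  [have := dis x (mem_head _ _); case: (A x) => //= ->
 | apply: IH => j js; apply: dis; rewrite inE js orbT].
Qed.

Definition code {n} (v : 'S_n) k := count (in_rothe v k) (iota 0 n).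

Lemma lehmerE n (v : 'S_n) (i : 'I_n) : lehmer v i = code v i.
Proof.
rewrite /lehmer /code cardE /enum_mem size_filter -enumT -val_enum_ord
  count_map.
by apply: eq_count => j /=; rewrite !inE /in_rothe !perm_nat_ord.
Qed.

Lemma nth_mu_of n (v : 'S_n) i j :
  (j < nth 0 (mu_of v) i) = (i < count (fun k => j < code v k) (iota 0 n)).
Proof.
rewrite /mu_of nth_sort_geq count_map -val_enum_ord count_map.
by congr (_ < _); apply: eq_count => k /=; rewrite lehmerE.
Qed.

Lemma count_le_iota (A : pred nat) n m :
  (forall j, j < n -> A j -> j < m) -> m <= n ->
  count A (iota 0 n) = count A (iota 0 m).
Proof.
move=> Am le_mn; rewrite -{1}(subnKC le_mn) iotaD count_cat [X in _ + X](_ :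
  _ = 0) ?addn0 //.
apply/eqP; rewrite -leqn0 leqNgt -has_count; apply/hasPn => j.
rewrite mem_iota => /andP[hm hn]; apply/negP => /Am; lia.
Qed.

Lemma rothe_rank_rows n (v : 'S_n) p q :
  rothe_rank v p q = count (fun k => perm_nat v k < q) (iota 0 p).
Proof.
elim: p => [|p IH]; last by rewrite rothe_rankSl count_iotaS IH.
by rewrite /rothe_rank (@eq_count _ _ pred0) ?count_pred0.
Qed.

Lemma in_rothe_Ylambda n (v : 'S_n) p q : in_rothe v p q -> in_Ylambda v p q.
Proof. by move=> D; apply/in_YlambdaP; exists p, q. Qed.

Section Shape.
Variables (n : nat) (v : 'S_n).
Hypothesis v_vex : vexillary v.

Let L := in_Ylambda v.

(* The vertices (p, q) on the closure of the Young diagram of lambda^(v). *)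
Definition in_closure p q := [|| p == 0, q == 0 | in_Ylambda v p.-1 q.-1].

(** Such a cell would give the inversion of the values [j < v k] at the positions [k < v^-1 j],
    which is impossible at the cell [(p.-1, q.-1)] of lambda. *)
Lemma in_closure_inc p q j k : in_closure p q -> in_rothe v k j ->
  perm_nat v k < q -> perm_nat v^-1 j < p -> False.
Proof.
move=> cl /andP[D1 D2] hk hj.
have pq : L p.-1 q.-1 by move: cl; rewrite /in_closure;
  case: eqP hj => [->|_]; case: eqP hk => [->|_].
apply: (no_inversion_in_Ylambda n v v_vex _ _ j (perm_nat v k) pq) => //.
- lia.
- by rewrite perm_natK.
- lia.
Qed.

(** All Rothe cells of row [k] lie in the first [q] columns, and they avoid the columns [j] with
    [v^-1 j < p], which [rothe_rank] counts. *)
Lemma code_le p q k : q <= n -> in_closure p q -> ~~ L p q ->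
  (perm_nat v k < q) || (p <= k) -> code v k + rothe_rank v p q <= q.
Proof.
move=> hq cl nL hk.
have Dq j : in_rothe v k j -> j < q.
  move=> D; case/orP: hk => [hk|hp]; first by case/andP: D => hj _;
    apply: ltn_trans hk.
  by rewrite ltnNge; apply: contra nL => hj; apply: in_Ylambda_le
    (in_rothe_Ylambda _ _ _ _ D) hp hj.
rewrite /code (count_le_iota _ n q) //; last by move=> j _; apply: Dq.
rewrite -{3}(size_iota 0 q); apply: count_disjoint => j _ D.
apply/negP => hj; case/orP: hk => hk; first exact: (in_closure_inc p q j k).
by case/andP: D => _; lia.
Qed.

(** Each column [j < q] with [p <= v^-1 j] gives a Rothe cell in row [k]. *)
Lemma code_ge p q k : q <= n -> k < p -> q <= perm_nat v k ->
  q <= code v k + rothe_rank v p q.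
Proof.
move=> hq hk hv; rewrite -{1}(size_iota 0 q).
rewrite -(count_predC (fun j => perm_nat v^-1 j < p)) addnC leq_add2r /code.
have -> : iota 0 n = iota 0 q ++ iota q (n - q) by rewrite -iotaD subnKC.
rewrite count_cat; apply: leq_trans (leq_addr _ _).
rewrite -!size_filter; apply: uniq_leq_size; first by rewrite filter_uniq
  ?iota_uniq.
move=> j; rewrite !mem_filter mem_iota /in_rothe /= -leqNgt; lia.
Qed.

(** With [s] the Rothe rank at [(p, q)], exactly [p - s] rows [k < p] have [q <= v k]. Their codes
    are at least [q - s] by [code_ge], and all other codes are at most [q - s] by [code_le]. *)
Lemma nth_mu_boundary i j rho : i + rho <= n -> j + rho <= n ->
  in_closure (i + rho) (j + rho) -> ~~ L (i + rho) (j + rho) ->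
  (j < nth 0 (mu_of v) i) = (rothe_rank v (i + rho) (j + rho) < rho).
Proof.
set p := i + rho; set q := j + rho => hp hq cl nL; rewrite nth_mu_of.
have cle := code_le _ _ _ hq cl nL; have cge k := code_ge p q k hq.
have cnt := count_predC (fun k => perm_nat v k < q) (iota 0 p).
rewrite -rothe_rank_rows size_iota in cnt.
apply/idP/idP => [|lt_rho].
  apply: contraLR; rewrite -!leqNgt => le_rho.
  rewrite (count_le_iota _ n p) //; last first.
    by move=> k _ hk; rewrite ltnNge; apply/negP => hpk; have := cle k;
      rewrite hpk orbT => /(_ isT); lia.
  have : count (fun k => j < code v k) (iota 0 p) <= count (predC (fun k =>
    perm_nat v k < q)) (iota 0 p).
    apply: sub_count => k hk /=; apply/negP => hvk.
    by have := cle k; rewrite hvk => /(_ isT); lia.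
  lia.
have : count (predC (fun k => perm_nat v k < q)) (iota 0 p) <= count (fun k
  => j < code v k) (iota 0 p).
  rewrite -!size_filter; apply: uniq_leq_size; first by rewrite filter_uniq
    ?iota_uniq.
  move=> k; rewrite !mem_filter mem_iota /= add0n -leqNgt => /andP[hvk hk].
  by have := cge k hk hvk; rewrite hk; lia.
have -> : iota 0 n = iota 0 p ++ iota p (n - p) by rewrite -iotaD subnKC.
by rewrite count_cat; lia.
Qed.

Lemma nth_mu_le i j i' j' : j < nth 0 (mu_of v) i -> i' <= i -> j' <= j ->
  j' < nth 0 (mu_of v) i'.
Proof.
rewrite !nth_mu_of => h hi hj; apply: leq_ltn_trans hi _; apply: leq_trans h _.
by apply: sub_count => k; apply: leq_ltn_trans.
Qed.

Lemma nth_mu_lt i j : j < nth 0 (mu_of v) i -> (i < n) && (j < n).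
Proof.
rewrite nth_mu_of => h.
have := count_size (fun k => j < code v k) (iota 0 n); rewrite size_iota => hc.
have : has (fun k => j < code v k) (iota 0 n) by rewrite has_count; lia.
case/hasP=> k _ hk; have := count_size (in_rothe v k) (iota 0 n);
  rewrite size_iota.
by rewrite -/(code v k); lia.
Qed.

(* Otherwise the diagonal of a cell of mu would start outside lambda, and
   nth_mu_boundary there (with rho = 0) would put its first cell outside mu. *)
Lemma nth_mu_Ylambda i j : j < nth 0 (mu_of v) i -> L (i - minn i j) (j -
  minn i j).
Proof.
move=> h; apply: contraT => nL; have /andP[hi hj] := nth_mu_lt _ _ h.
have := nth_mu_boundary (i - minn i j) (j - minn i j) 0; rewrite !addn0.
rewrite (nth_mu_le i j) ?leq_subr // ltn0.
suff cl : in_closure (i - minn i j) (j - minn i j).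
  by move=> H; suff: true = false by []; apply: H => //; lia.
by rewrite /in_closure; have [hij|hij] := leqP i j; rewrite subnn eqxx ?orbT.
Qed.

Lemma leq_flag_of i j k : nth 0 (mu_of v) i = j.+1 -> i <= k ->
  (k <= flag_of v i) = L k (k + j - i).
Proof.
move=> mi ik; rewrite /flag_of mi.
apply/idP/idP => [hk|Lk].
  (* The maximum defining the flag ranges over a nonempty set, hence is attained and is not the
     default 0. *)
  have /nth_mu_Ylambda Ls : j < nth 0 (mu_of v) i by rewrite mi.
  have /andP[hs _] := in_Ylambda_lt _ _ _ _ Ls.
  pose Q := [pred l : 'I_n | (i < l + j.+1) && in_Ylambda v l ((l + j.+1).-1
    - i)].
  have : 0 < #|Q|.
    apply/card_gt0P; exists (Ordinal hs); rewrite inE /=.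
    apply/andP; split; first lia.
    by apply: in_Ylambda_le Ls _ _; lia.
  case/(eq_bigmax_cond (fun j : 'I_n => j : nat)) => l;
    rewrite unfold_in /Q => /andP[_ Ll] e.
  by apply: in_Ylambda_le Ll _ _; move: hk; rewrite e; lia.
have /andP[hk _] := in_Ylambda_lt _ _ _ _ Lk.
apply: (leq_bigmax_cond (Ordinal hk)) => /=; apply/andP; split; first lia.
by apply: in_Ylambda_le Lk _ _; lia.
Qed.

End Shape.

(** * From tableaux to rank functions *)

Section RankOf.
Variable g : nat -> nat -> nat -> bool.

(** Here [g i j p] abstracts [p <= T(i, j)], with infinite entries outside the shape. *)
Definition rank_of p q : nat :=
  \max_(rho < (minn p q).+1 | g (p - rho) (q - rho) p) rho.

Hypotheses (g_row : forall i j, g i j i)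
  (g_anti : forall i j p, g i j p.+1 -> g i j p)
  (g_right : forall i j p, g i j p -> g i j.+1 p)
  (g_down : forall i j p, g i j p -> g i.+1 j p.+1).

Lemma rank_of_le p q : rank_of p q <= minn p q.
Proof. by apply/bigmax_leqP => i _; rewrite -ltnS. Qed.

(** The admissible shifts form an initial segment: by [g_right], [g_down] and [g_anti], the
    condition passes from a cell to the next one on its diagonal. The shift 0 is admissible by
    [g_row]. *)
Lemma leq_rank_of i j rho : (rho <= rank_of (i + rho) (j + rho)) = g i j (i +
  rho).
Proof.
apply/idP/idP => [|gi]; last first.
  have lt : rho < (minn (i + rho) (j + rho)).+1 by lia.
  by apply: (leq_bigmax_cond (Ordinal lt)); rewrite /= !addnK.
rewrite /rank_of; set Q := (X in bigop _ _ X).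
have : 0 < #|[pred l : 'I_(minn (i + rho) (j + rho)).+1 |
    g (i + rho - l) (j + rho - l) (i + rho)]|.
  have lt : 0 < (minn (i + rho) (j + rho)).+1 by lia.
  apply/card_gt0P; exists (Ordinal lt); rewrite inE /= subn0.
  exact: g_row.
case/(eq_bigmax_cond (fun l : 'I_ _ => l : nat)) => l;
  rewrite inE /Q => gl -> le_l.
have lt := ltn_ord l; rewrite ltnS leq_min in lt.
have {gl} : g (i - (l - rho)) (j - (l - rho)) (i + rho) by move: gl; congr g;
  lia.
have : l - rho <= minn i j by lia.
elim: (l - rho) => [|d IH] hd; first by rewrite !subn0.
move=> h; apply: IH; first lia.
by have := g_anti _ _ _ (g_down _ _ _ (g_right _ _ _ h)); congr g; lia.
Qed.

Lemma leq_rank_ofE p q rho : rho <= p -> rho <= q ->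
  (rho <= rank_of p q) = g (p - rho) (q - rho) p.
Proof. by move=> hp hq; rewrite -{1}(subnK hp) -{1}(subnK hq) leq_rank_of
  subnK. Qed.

(** A horizontal step with a fixed shift moves to the cell on the right; raising the shift at the
    same time moves to the cell above. *)
Lemma rank_of_right p q : rank_of p q <= rank_of p q.+1 <= (rank_of p q).+1.
Proof.
have := rank_of_le p q; have := rank_of_le p q.+1.
rewrite !leq_min => /andP[h1 h2] /andP[h3 h4]; apply/andP; split.
  rewrite leq_rank_ofE ?(leqW h4) // subSn //; apply: g_right.
  by rewrite -leq_rank_ofE.
case E: (rank_of p q.+1) h1 h2 => [//|d] h1 h2;
  rewrite ltnS leq_rank_ofE ?(ltnW h1) //.
have : d < rank_of p q.+1 by rewrite E.
rewrite leq_rank_ofE // => /g_down /g_anti; congr g; lia.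
Qed.

Lemma rank_of_down p q : rank_of p q <= rank_of p.+1 q <= (rank_of p q).+1.
Proof.
have := rank_of_le p q; have := rank_of_le p.+1 q.
rewrite !leq_min => /andP[h1 h2] /andP[h3 h4]; apply/andP; split.
  rewrite leq_rank_ofE ?(leqW h3) // subSn //; apply: g_down.
  by rewrite -leq_rank_ofE.
case E: (rank_of p.+1 q) h1 h2 => [//|d] h1 h2;
  rewrite ltnS leq_rank_ofE ?(ltnW h2) //.
have : d < rank_of p.+1 q by rewrite E.
rewrite leq_rank_ofE // => /g_right /g_anti; congr g; lia.
Qed.

Lemma rank_of_diag p q : rank_of p.+1 q.+1 <= (rank_of p q).+1.
Proof.
have := rank_of_le p.+1 q.+1; rewrite leq_min => /andP[h1 h2].
case E: (rank_of p.+1 q.+1) h1 h2 => [//|d] h1 h2; rewrite ltnS leq_rank_ofE //.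
have : d < rank_of p.+1 q.+1 by rewrite E.
by rewrite leq_rank_ofE // !subSS => /g_anti.
Qed.

End RankOf.

Lemma mem_young mu i j : ((i, j) \in young mu) = (j < nth 0 mu i).
Proof.
rewrite /young inE /=; apply/allpairsPdep/idP => [[a [b]]|h].
  by rewrite !mem_iota /= !add0n => -[_ + [-> ->]].
exists i, j; rewrite !mem_iota /= !add0n; split=> //.
by rewrite ltnNge; apply/negP => hs; rewrite nth_default in h.
Qed.

Lemma cell_in mu (c : young mu) : colc c < nth 0 mu (rowc c).
Proof. by rewrite -mem_young /rowc /colc -surjective_pairing;
  apply: fsvalP. Qed.

Lemma cell_exists mu i j : j < nth 0 mu i -> exists c : young mu, rowc c = i
  /\ colc c = j.
Proof. by rewrite -mem_young => h; exists [` h]%fset. Qed.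

Lemma cell_inj mu (c d : young mu) : rowc c = rowc d -> colc c = colc d -> c
  = d.
Proof.
move=> h1 h2; apply: val_inj; move: h1 h2; rewrite /rowc /colc.
by case: (val c) (val d) => [a b] [a' b'] /= -> ->.
Qed.

(** Holds vacuously outside the shape, as if the entries there were infinite. *)
Definition entry_ge {mu} (T : tableau mu) i j p : bool :=
  [forall c : young mu, (rowc c == i) && (colc c == j) ==> (p <= T c)].

Lemma entry_geE mu (T : tableau mu) (c : young mu) p :
  entry_ge T (rowc c) (colc c) p = (p <= T c).
Proof.
apply/forallP/idP => [/(_ c)|h d]; first by rewrite !eqxx.
by apply/implyP => /andP[/eqP h1 /eqP h2]; rewrite (cell_inj _ d c).
Qed.

Lemma entry_ge_out mu (T : tableau mu) i j p :
  nth 0 mu i <= j -> entry_ge T i j p.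
Proof.
move=> h; apply/forallP => c; apply/implyP => /andP[/eqP h1 /eqP h2].
by have := cell_in _ c; rewrite h1 h2 ltnNge h.
Qed.

Lemma entry_geP mu (T : tableau mu) i j p :
  reflect (forall c, rowc c = i -> colc c = j -> p <= T c) (entry_ge T i j p).
Proof.
apply: (iffP forallP) => [h c e1 e2|h c].
  by have := h c; rewrite e1 e2 !eqxx.
by apply/implyP => /andP[/eqP e1 /eqP e2]; apply: h.
Qed.

Definition partition_like (mu : seq nat) : Prop :=
  forall i j i' j', j < nth 0 mu i -> i' <= i -> j' <= j -> j' < nth 0 mu i'.

Section SemistandardRank.
Variables (mu : seq nat) (T : tableau mu).
Hypotheses (mu_part : partition_like mu) (T_ss : semistandard T).

Lemma entry_ge_row i j : entry_ge T i j i.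
Proof.
elim: i => [|i IH]; apply/entry_geP => c e1 e2 //.
have [d [d1 d2]] : exists d : young mu, rowc d = i /\ colc d = j.
  apply: cell_exists; rewrite -e2; apply: mu_part (cell_in _ c) _ _; lia.
rewrite -d1 -d2 entry_geE in IH; apply: leq_ltn_trans (_ : T d < T c);
  first by rewrite -d1.
by have [_] := T_ss; apply; lia.
Qed.

Lemma entry_ge_anti i j p p' : p' <= p -> entry_ge T i j p -> entry_ge T i j p'.
Proof.
by move=> hp /entry_geP h; apply/entry_geP => c e1 e2;
  apply: leq_trans hp (h c e1 e2).
Qed.

Lemma entry_ge_right i j p : entry_ge T i j p -> entry_ge T i j.+1 p.
Proof.
move=> /entry_geP h; apply/entry_geP => c e1 e2.
have [d [d1 d2]] : exists d : young mu, rowc d = i /\ colc d = j.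
  by apply: cell_exists; apply: mu_part (cell_in _ c) _ _; lia.
by apply: leq_trans (h d d1 d2) _; have [+ _] := T_ss; apply; lia.
Qed.

Lemma entry_ge_down i j p : entry_ge T i j p -> entry_ge T i.+1 j p.+1.
Proof.
move=> /entry_geP h; apply/entry_geP => c e1 e2.
have [d [d1 d2]] : exists d : young mu, rowc d = i /\ colc d = j.
  by apply: cell_exists; apply: mu_part (cell_in _ c) _ _; lia.
by apply: leq_ltn_trans (h d d1 d2) _; have [_] := T_ss; apply; lia.
Qed.

Definition tableau_rank := rank_of (entry_ge T).

Lemma tableau_rank_le p q : tableau_rank p q <= minn p q.
Proof. exact: rank_of_le. Qed.

Lemma leq_tableau_rank p q rho : rho <= p -> rho <= q ->
  (rho <= tableau_rank p q) = entry_ge T (p - rho) (q - rho) p.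
Proof.
apply: leq_rank_ofE; [exact: entry_ge_row | move=> i j r; exact: entry_ge_anti
  | exact: entry_ge_right | exact: entry_ge_down].
Qed.

Lemma leq_tableau_rank_cell i j rho :
  (rho <= tableau_rank (i + rho) (j + rho)) = entry_ge T i j (i + rho).
Proof. by rewrite leq_tableau_rank ?leq_addl // !addnK. Qed.

Lemma tableau_rank_right p q :
  tableau_rank p q <= tableau_rank p q.+1 <= (tableau_rank p q).+1.
Proof.
apply: rank_of_right; [exact: entry_ge_row | move=> i j r; exact: entry_ge_anti
  | exact: entry_ge_right | exact: entry_ge_down].
Qed.

Lemma tableau_rank_down p q :
  tableau_rank p q <= tableau_rank p.+1 q <= (tableau_rank p q).+1.
Proof.
apply: rank_of_down; [exact: entry_ge_row | move=> i j r; exact: entry_ge_anti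
  | exact: entry_ge_right | exact: entry_ge_down].
Qed.

Lemma tableau_rank_diag p q : tableau_rank p.+1 q.+1 <= (tableau_rank p q).+1.
Proof.
apply: rank_of_diag; [exact: entry_ge_row | move=> i j r; exact: entry_ge_anti
  | exact: entry_ge_right | exact: entry_ge_down].
Qed.

Lemma row_leq_entry c : rowc c <= T c.
Proof. by rewrite -entry_geE entry_ge_row. Qed.

End SemistandardRank.

Section FlaggedRank.
Variables (n : nat) (v : 'S_n).
Hypothesis v_vex : vexillary v.
Let L := in_Ylambda v.

Lemma mu_of_partition : partition_like (mu_of v).
Proof. exact: nth_mu_le. Qed.

Lemma in_closure_prev p q p' q' : p' <= p -> q' <= q ->
  in_closure n v p q -> in_closure n v p' q'.
Proof.
rewrite /in_closure => hp hq.
case: (eqVneq p' 0) => //= p0; case: (eqVneq q' 0) => //= q0.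
case: (eqVneq p 0) => [e|_ /=]; first lia.
case: (eqVneq q 0) => [e|_ /=]; first lia.
by move=> Lpq; apply: in_Ylambda_le Lpq _ _; lia.
Qed.

Lemma Ylambda_closure p q : L p q -> in_closure n v p q.
Proof. by move=> Lpq; apply: (in_closure_prev p.+1 q.+1). Qed.

Lemma good_tile_outside r k l : good_rank n v r -> k < n -> l < n ->
  ~~ L k l -> tile_at r k l = tile_at (rothe_rank v) k l.
Proof.
move=> [cr off _] hk hl nL.
have out p q : k <= p <= n -> l <= q <= n -> r p q = rothe_rank v p q.
  move=> /andP[hkp hp] /andP[hlq hq]; apply: off => //.
  by apply: contra nL => Lpq; apply: in_Ylambda_le Lpq _ _.
by rewrite /tile_at !out ?hk ?hl ?leqnn ?leqnSn //= ltnW.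
Qed.

(** Outside lambda the tiles are those of the Rothe pipe dream, whose blanks form the Rothe diagram,
    a subset of lambda. *)
Lemma good_blank_Ylambda r k l : good_rank n v r -> k < n -> l < n ->
  tile_at r k l = Blank -> L k l.
Proof.
move=> gr hk hl; apply: contraPT => nL; rewrite (good_tile_outside r) // => e.
move: nL; apply/negP/negPn/in_rothe_Ylambda; rewrite /in_rothe; move: e.
have := rothe_rankS n v k l; have := rothe_rankSl n v k l.
have := rothe_rankS n v k.+1 l; have := rothe_rankSl n v k l.+1.
by case: (tileP _ _ _ _ (rothe_corner n v) hk hl) => //; lia.
Qed.

Lemma good_up_Ylambda r k l : good_rank n v r -> k < n -> l < n ->
  tile_at r k l = UpElbow -> L k l.
Proof.
move=> gr hk hl; apply: contraPT => nL; rewrite (good_tile_outside r) //.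
have := rothe_rankS n v k l; have := rothe_rankSl n v k l.
have := rothe_rankS n v k.+1 l; have := rothe_rankSl n v k l.+1.
by case: (tileP _ _ _ _ (rothe_corner n v) hk hl) => //; lia.
Qed.

(** Inside lambda, with crossings excluded, the rank grows along the diagonal of a cell by 0 at a
    blank and by 1 otherwise. The induction follows diagonals from the top and left boundaries. *)
Lemma good_rank_unique r r' : good_rank n v r -> good_rank n v r' ->
  (forall k l, L k l -> (tile_at r k l == Blank) = (tile_at r' k l == Blank)) ->
  forall p q, p <= n -> q <= n -> r p q = r' p q.
Proof.
move=> [cr off nc] [cr' off' nc'] same; have [bd _ _] := cr;
  have [bd' _ _] := cr'.
elim=> [|p IH] [|q] hp hq.
- by have [-> _ _ _] := bd 0 hp; have [-> _ _ _] := bd' 0 hp.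
- by have [-> _ _ _] := bd q.+1 hq; have [-> _ _ _] := bd' q.+1 hq.
- by have [_ -> _ _] := bd p.+1 hp; have [_ -> _ _] := bd' p.+1 hp.
have [Lpq|nL] := boolP (L p q); last first.
  have nL' : ~~ L p.+1 q.+1 by apply: contra nL => h;
    apply: in_Ylambda_le h _ _.
  by rewrite off // off'.
have := same p q Lpq; have := nc p q Lpq; have := nc' p q Lpq.
have := IH q (ltnW hp) (ltnW hq); rewrite /no_crossing_at.
by case: (tileP _ _ _ _ cr hp hq) => _ _ ->; case: (tileP _ _ _ _ cr' hp hq)
  => _ _ -> //; lia.
Qed.

End FlaggedRank.

Section TableauToRank.
Variables (n : nat) (v : 'S_n).
Hypothesis v_vex : vexillary v.
Let L := in_Ylambda v.
Variable T : tableau (mu_of v).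
Hypothesis T_fss : FSYT v T.

Let T_ss : semistandard T := T_fss.1.
Let mu_part := mu_of_partition n v.
Let rT := tableau_rank (mu_of v) T.
Let row_le := row_leq_entry _ T mu_part T_ss.

(** [leq_flag_of] concerns the last cell of a row; for the other cells the position moves left, and
    lambda is closed under that. *)
Lemma entry_Ylambda c k : rowc c <= k -> k <= T c -> L k (k + colc c - rowc c).
Proof.
move=> hr hk; have [_ /(_ c) fl] := T_fss.
have := cell_in _ c; case e : (nth 0 _ (rowc c)) => [//|j] hj.
have := leq_flag_of n v v_vex _ _ k e hr; rewrite (leq_trans hk fl) => /esym Lk.
by apply: in_Ylambda_le Lk _ _; lia.
Qed.

(** By [nth_mu_boundary], the Rothe rank is at least [rho] exactly when the cell
    [(p - rho, q - rho)] is outside the shape. For the tableau rank the alternative is an entry at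
    least [p], but then the flag would put [(p, q)] inside lambda. *)
Lemma tableau_rank_boundary p q : p <= n -> q <= n ->
  in_closure n v p q -> ~~ L p q -> rT p q = rothe_rank v p q.
Proof.
move=> hp hq cl nL.
have rv_le : rothe_rank v p q <= minn p q.
  rewrite leq_min {1}rothe_rank_rows; apply/andP; split.
    by rewrite -{2}(size_iota 0 p) count_size.
  by rewrite -{2}(size_iota 0 q) count_size.
have rT_le := tableau_rank_le _ T p q.
suff same rho : rho <= minn p q -> (rho <= rT p q) = (rho <= rothe_rank v p q).
  apply/eqP; rewrite eqn_leq; apply/andP; split.
    by rewrite -same // leqnn.
  by rewrite same // leqnn.
rewrite leq_min => /andP[h1 h2]; rewrite /rT (leq_tableau_rank _ T) //.
have := nth_mu_boundary n v v_vex (p - rho) (q - rho) rho.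
rewrite !subnK // => /(_ hp hq cl nL) e.
rewrite leqNgt -e; apply/idP/idP => [|]; last by rewrite -leqNgt =>
  /entry_ge_out.
apply: contraL => /cell_exists[c [e1 e2]]; rewrite -e1 -e2 entry_geE.
apply: contra nL => hpT; have hpr : rowc c <= T c by apply: row_le.
by apply: in_Ylambda_le (entry_Ylambda c (T c) hpr (leqnn _)) _ _; lia.
Qed.

Definition glued_rank p q :=
  if in_Ylambda v p q then rT p q else rothe_rank v p q.

Lemma glued_rank_closure p q : p <= n -> q <= n -> in_closure n v p q ->
  glued_rank p q = rT p q.
Proof.
move=> hp hq cl; rewrite /glued_rank; case: ifPn => // nL.
by rewrite tableau_rank_boundary.
Qed.

(** Every grid edge has both ends in the closure of lambda or both outside lambda, so each unit step
    takes place within one of the two ranks. *)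
Lemma glued_rank_good : good_rank n v glued_rank.
Proof.
have [bd hh hv] := rothe_corner n v.
split=> [|p q _ _ /negbTE nL|i j Lij]; last 2 first.
- by rewrite /glued_rank nL.
- have /andP[hi hj] := in_Ylambda_lt _ _ _ _ Lij.
  have cl : in_closure n v i.+1 j.+1 by [].
  have cl' : in_closure n v i j by apply: Ylambda_closure.
  rewrite /no_crossing_at (glued_rank_closure _ _ hi hj cl).
  rewrite (glued_rank_closure _ _ (ltnW hi) (ltnW hj) cl').
  exact: tableau_rank_diag.
split=> [p hp|p q hp hq|p q hp hq].
- have nLr : in_Ylambda v n p = false by apply/negbTE/negP => /in_Ylambda_lt;
    rewrite ltnn.
  have nLl : in_Ylambda v p n = false by apply/negbTE/negP => /in_Ylambda_lt;
    rewrite ltnn andbF.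
  rewrite {3 4}/glued_rank nLr nLl; have [_ _ -> ->] := bd p hp.
  rewrite !glued_rank_closure // /in_closure ?eqxx ?orbT //.
  have := tableau_rank_le _ T 0 p; have := tableau_rank_le _ T p 0.
  by rewrite min0n minn0 !leqn0 -/rT => /eqP-> /eqP->.
- have [cl|ncl] := boolP (in_closure n v p q.+1).
    rewrite !glued_rank_closure //; first exact: tableau_rank_right.
      exact: ltnW.
    exact: in_closure_prev cl.
  have nL : in_Ylambda v p q = false.
    by apply/negbTE/negP => Lpq; case/negP: ncl;
      apply: (in_closure_prev n v p.+1 q.+1).
  have nL' : in_Ylambda v p q.+1 = false.
    by apply/negbTE; move/negbT: nL; apply: contra => Lpq;
      apply: in_Ylambda_le Lpq _ _.
  by rewrite /glued_rank nL nL' hh.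
have [cl|ncl] := boolP (in_closure n v p.+1 q).
  rewrite !glued_rank_closure //; first exact: tableau_rank_down.
    exact: ltnW.
  exact: in_closure_prev cl.
have nL : in_Ylambda v p q = false.
  by apply/negbTE/negP => Lpq; case/negP: ncl; apply: (in_closure_prev n v
    p.+1 q.+1).
have nL' : in_Ylambda v p.+1 q = false.
  by apply/negbTE; move/negbT: nL; apply: contra => Lpq;
    apply: in_Ylambda_le Lpq _ _.
by rewrite /glued_rank nL nL' hv.
Qed.

Lemma glued_tile k l : L k l -> tile_at glued_rank k l = tile_at rT k l.
Proof.
move=> Lkl; have /andP[hk hl] := in_Ylambda_lt _ _ _ _ Lkl.
have cl : in_closure n v k.+1 l.+1 by [].
have out p q : p <= k.+1 -> q <= l.+1 -> glued_rank p q = rT p q.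
  move=> hp hq; apply: glued_rank_closure; [lia | lia |].
  exact: in_closure_prev hp hq cl.
by rewrite /tile_at !out.
Qed.

(** Shift [rho] at [(k, l)] and shift [rho.+1] at [(k.+1, l.+1)] test the same cell, against [k] and
    [k.+1]. The rank therefore stays constant exactly when some cell of the diagonal has the entry
    [k]. *)
Lemma glued_blankP k l : k < n -> l < n ->
  reflect (exists2 c, T c = k & entry_pos c k = (k, l)) (tile_at glued_rank k
    l == Blank).
Proof.
move=> hk hl; apply: (iffP eqP) => [e|[c Tc]].
  have Lkl := good_blank_Ylambda n v _ k l glued_rank_good hk hl e.
  move: e; rewrite glued_tile // => e.
  have e1 : rT k.+1 l.+1 <= rT k l.
    by move/eqP: e; rewrite tile_blankE; lia.
  have := tableau_rank_le _ T k l; rewrite leq_min -/rT => /andP[h1 h2].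
  have g1 := leq_tableau_rank _ T mu_part T_ss k l _ h1 h2.
  have g2 := leq_tableau_rank _ T mu_part T_ss k.+1 l.+1 (rT k l).+1 h1 h2.
  rewrite -/rT leqnn in g1; rewrite -/rT ltnNge e1 !subSS /= in g2.
  have [c [c1 c2]] : exists c : young (mu_of v), rowc c = k - rT k l /\ colc
    c = l - rT k l.
    by apply: cell_exists; rewrite ltnNge; apply/negP =>
      /entry_ge_out-/(_ T k.+1); rewrite -g2.
  exists c; last by rewrite /entry_pos c1 c2; congr pair; lia.
  by move: g1 g2; rewrite -c1 -c2 !entry_geE; lia.
rewrite /entry_pos => -[el]; have hr := row_le c; rewrite Tc in hr.
have Lkl : L k l by rewrite -el -Tc; apply: entry_Ylambda; rewrite ?Tc.
rewrite glued_tile //.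
have g1 := leq_tableau_rank_cell _ T mu_part T_ss (rowc c) (colc c) (k - rowc
  c).
have g2 := leq_tableau_rank _ T mu_part T_ss k.+1 l.+1 (k - rowc c).+1.
rewrite !subSS in g2.
have ek : rowc c + (k - rowc c) = k by lia.
have er : k - (k - rowc c) = rowc c by lia.
have el1 : colc c + (k - rowc c) = l by lia.
have ec : l - (k - rowc c) = colc c by lia.
rewrite ek el1 entry_geE Tc leqnn -/rT in g1.
rewrite er ec entry_geE Tc ltnn -/rT in g2.
have {}g2 : (k - rowc c < rT k.+1 l.+1) = false by apply: g2; lia.
have := tableau_rank_right _ T mu_part T_ss k l;
  have := tableau_rank_down _ T mu_part T_ss k l.
have := tableau_rank_right _ T mu_part T_ss k.+1 l;
  have := tableau_rank_down _ T mu_part T_ss k l.+1.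
by rewrite -/rT => *; apply/eqP; rewrite tile_blankE; lia.
Qed.

End TableauToRank.

(** * From rank functions to tableaux *)

Section RankToTableau.
Variables (n : nat) (v : 'S_n).
Hypothesis v_vex : vexillary v.
Let L := in_Ylambda v.
Variable r : nat -> nat -> nat.
Hypothesis gr : good_rank n v r.

Let cr : corner_sum n r. Proof. by case: gr. Qed.

Lemma corner_right p q t : p <= n -> q + t <= n -> r p q <= r p (q + t) <= r
  p q + t.
Proof.
move=> hp; have [_ hh _] := cr; elim: t => [|t IH] ht;
  first by rewrite !addn0 leqnn.
by have := hh p (q + t) hp; rewrite -!addnS; lia.
Qed.

Lemma good_diag p q t : (forall u, u < t -> L (p + u) (q + u)) ->
  r (p + t) (q + t) <= r p q + t.
Proof.
have [_ _ nc] := gr; elim: t => [|t IH] ht; first by rewrite !addn0.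
have := nc _ _ (ht t (ltnSn t)); rewrite /no_crossing_at !addnS.
by have := IH (fun u hu => ht u (ltnW hu)); lia.
Qed.

Lemma good_diag_le p q p' q' : p <= p' -> p' + q = p + q' -> L p' q' ->
  r p' q' + p <= r p q + p'.
Proof.
move=> hp e Lpq; have := good_diag p q (p' - p).
have -> : p + (p' - p) = p' by lia.
have -> : q + (p' - p) = q' by lia.
move=> /(_ _)H; suff: r p' q' <= r p q + (p' - p) by lia.
by apply: H => u hu; apply: in_Ylambda_le Lpq _ _; lia.
Qed.

Lemma boundary_exists p q : L p q -> exists e,
  [/\ forall u, u < e -> L (p + u) (q + u), ~~ L (p + e) (q + e),
      0 < e & p + e <= n] /\ (q + e <= n) && in_closure n v (p + e) (q + e).
Proof.
move=> Lpq; have ex : exists e, ~~ L (p + e) (q + e).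
  by exists n; apply/negP => /in_Ylambda_lt /andP[]; rewrite ltnNge leq_addl.
case: (ex_minnP ex) => e nLe min_e; exists e.
have Le u : u < e -> L (p + u) (q + u).
  by apply: contraTT => /min_e; rewrite -leqNgt.
have he : 0 < e by rewrite lt0n; apply: contra nLe => /eqP->; rewrite !addn0.
case: e he Le {min_e nLe} (nLe) => // e _ Le nLe.
have Lp := Le e (ltnSn e); have /andP[h1 h2] := in_Ylambda_lt _ _ _ _ Lp.
by rewrite !addnS in nLe *; rewrite h2 /in_closure /= -/L Lp.
Qed.

Lemma boundary_shape i j rho : i + rho <= n -> j + rho <= n ->
  in_closure n v (i + rho) (j + rho) -> ~~ L (i + rho) (j + rho) ->
  (j < nth 0 (mu_of v) i) = (r (i + rho) (j + rho) < rho).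
Proof.
move=> hi hj cl nL; have [_ off _] := gr.
by rewrite off //; apply: nth_mu_boundary.
Qed.

(* Entry i + s of cell (i, j), that is, a blank tile at (i + s, j + s). *)
Definition has_entry i j s :=
  [/\ L (i + s) (j + s), r (i + s) (j + s) = s & r (i + s).+1 (j + s).+1 = s].

(** On the diagonal of [(i, j)], started at [(a, b)], the boundary vertex satisfies [r + m < t] by
    [boundary_shape]. At the first [t] where this happens the rank has not grown since the preceding
    vertex, whose cell is the required blank. *)
Lemma has_entry_exists i j : j < nth 0 (mu_of v) i -> exists s, has_entry i j s.
Proof.
move=> hij; have La := nth_mu_Ylambda n v v_vex i j hij; rewrite -/L in La.
set m := minn i j in La; set a := i - m in La; set b := j - m in La.
have ei : i = a + m by lia.
have ej : j = b + m by lia.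
have [e [[Le nLe he hae] /andP[hbe cl]]] := boundary_exists a b La.
have lt_me : m < e.
  rewrite ltnNge; apply/negP => le_em.
  have := boundary_shape (a + e) (b + e) 0; rewrite !addn0 ltn0.
  move=> /(_ hae hbe cl nLe); rewrite (nth_mu_le _ _ i j) //; lia.
have re : r (a + e) (b + e) + m < e.
  have := boundary_shape i j (e - m); rewrite hij.
  have -> : i + (e - m) = a + e by lia.
  have -> : j + (e - m) = b + e by lia.
  by move=> /(_ hae hbe cl nLe) /esym; lia.
have ex : exists t, r (a + t) (b + t) + m < t by exists e.
case: (ex_minnP ex) => t rt min_t; have le_te := min_t e re.
case: t rt min_t le_te => // t rt min_t lt_te.
have rt' : t <= r (a + t) (b + t) + m by rewrite leqNgt;
  apply/negP => /min_t; rewrite ltnn.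
have Lt := Le t lt_te; have /andP[hat hbt] := in_Ylambda_lt _ _ _ _ Lt.
have mono : r (a + t) (b + t) <= r (a + t).+1 (b + t).+1.
  by case: (tileP _ _ _ _ cr hat hbt) => _ _ ->; lia.
exists (t - m); rewrite /has_entry.
have -> : i + (t - m) = a + t by lia.
have -> : j + (t - m) = b + t by lia.
by rewrite !addnS in rt; split=> //; lia.
Qed.

(** If [s' < s], go from the lower right corner of the blank for [s'] left to the diagonal of
    [(i, j)], then down it to [(i + s, j + s)]: the rank there is at most [s - 1], not [s]. *)
Lemma has_entry_row i j j' s s' : j <= j' ->
  has_entry i j s -> has_entry i j' s' -> s <= s'.
Proof.
move=> hj [Ls e1 e2] [Ls' e1' e2']; rewrite leqNgt; apply/negP => lt_s.
have /andP[h1 h2] := in_Ylambda_lt _ _ _ _ Ls'.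
have := corner_right (i + s').+1 (j + s').+1 (j' - j) h1.
have -> : (j + s').+1 + (j' - j) = (j' + s').+1 by lia.
move=> /(_ h2); rewrite e2'.
have := good_diag_le (i + s').+1 (j + s').+1 (i + s) (j + s); rewrite e1.
by move=> /(_ _ _ Ls); lia.
Qed.

(** Otherwise go from the lower right corner of the blank for [s'] one step up, then right to the
    diagonal of [(i, j)], and down it to [(i + s, j + s)]; again the rank there is at most
    [s - 1]. *)
Lemma has_entry_col i i' j s s' : i < i' ->
  has_entry i j s -> has_entry i' j s' -> i + s < i' + s'.
Proof.
move=> hi [Ls e1 e2] [Ls' e1' e2']; rewrite ltnNge; apply/negP => le_s.
have /andP[h1 h2] := in_Ylambda_lt _ _ _ _ Ls'.
have /andP[h3 h4] := in_Ylambda_lt _ _ _ _ Ls.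
have [_ _ hv] := cr; have := hv _ (j + s').+1 h1 h2; rewrite e2'.
have := corner_right (i' + s') (j + s').+1 (i' - i).-1 (ltnW h1).
have -> : (j + s').+1 + (i' - i).-1 = j + (i' + s' - i) by lia.
have := good_diag_le (i' + s') (j + (i' + s' - i)) (i + s) (j + s); rewrite e1.
by move=> /(_ _ _ Ls); lia.
Qed.

Lemma has_entry_uniq i j s s' : has_entry i j s -> has_entry i j s' -> s = s'.
Proof.
move=> h h'; apply/eqP; rewrite eqn_leq (has_entry_row _ _ _ _ _ (leqnn j) h
  h').
exact: has_entry_row (leqnn j) h' h.
Qed.

Lemma corner_le p q : p <= n -> q <= n -> r p q <= minn p q.
Proof.
move=> hp hq; have [bd _ hv] := cr; rewrite leq_min; apply/andP; split.
  have [_ _ _ rp] := bd p hp.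
  have := corner_right p q (n - q) hp; rewrite subnKC // rp =>
    /(_ (leqnn n)); lia.
have [_ r0 _ _] := bd p hp.
by have := corner_right p 0 q hp; rewrite add0n r0 => /(_ hq); lia.
Qed.

(** To see that the cell lies in the shape, follow the diagonal to the boundary of lambda: the step
    through the blank adds nothing to the rank, which ends below the shift as [boundary_shape]
    requires. *)
Lemma blank_has_entry k l : k < n -> l < n -> tile_at r k l = Blank ->
  exists i j, [/\ j < nth 0 (mu_of v) i, has_entry i j (r k l),
    k = i + r k l & l = j + r k l].
Proof.
move=> hk hl e; have Lkl := good_blank_Ylambda n v r k l gr hk hl e.
have := corner_le k l (ltnW hk) (ltnW hl); rewrite leq_min => /andP[le_k le_l].
have e2 : r k.+1 l.+1 = r k l by move: e; case: (tileP _ _ _ _ cr hk hl).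
exists (k - r k l), (l - r k l); split; try lia; last first.
  by rewrite /has_entry !subnK.
have [e' [[Le nLe he hke] /andP[hle cl]]] := boundary_exists k l Lkl.
rewrite (boundary_shape _ _ (r k l + e')); rewrite ?addnA ?subnK //.
case: e' he Le {nLe hke hle cl} => // e' _ Le; rewrite -!addSnnS.
have := good_diag k.+1 l.+1 e'; rewrite e2 => H;
  suff : r (k.+1 + e') (l.+1 + e') <= r k l + e' by lia.
by apply: H => u hu; rewrite !addSnnS; apply: Le.
Qed.

Lemma good_rank_tableau : exists T : tableau (mu_of v),
  FSYT v T /\ forall p q, p <= n -> q <= n -> glued_rank n v T p q = r p q.
Proof.
have ex (c : young (mu_of v)) : exists s, has_entry (rowc c) (colc c) s.
  exact: has_entry_exists (cell_in _ c).
have /fin_all_exists[s hs] := ex.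
pose T : tableau (mu_of v) := [ffun c => rowc c + s c].
have T_ss : semistandard T.
  split=> c d h1 h2; rewrite !ffunE.
    by rewrite h1 leq_add2l; apply: (has_entry_row (rowc d) (colc c) (colc
      d)) => //; rewrite -h1.
  by apply: (has_entry_col _ _ (colc d)) => //; rewrite -h1.
have fss : FSYT v T.
  split=> // c; have := cell_in _ c; case e : (nth 0 _ _) => [//|j] hj.
  have [d [d1 d2]] : exists d : young (mu_of v), rowc d = rowc c /\ colc d = j.
    by apply: cell_exists; rewrite e.
  have [mono _] := T_ss; apply: leq_trans (mono c d _ _) _; rewrite ?d1 ?d2 //.
  rewrite /T ffunE d1 (leq_flag_of n v v_vex _ j _ e) ?leq_addr //.
  by have [Ld _ _] := hs d; apply: in_Ylambda_le Ld _ _; rewrite ?d1 ?d2 //;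
    lia.
exists T; split=> //; apply: (good_rank_unique n v) => //;
  first exact: glued_rank_good.
move=> k l Lkl; have /andP[hk hl] := in_Ylambda_lt _ _ _ _ Lkl.
apply/(glued_blankP n v v_vex T fss k l hk hl)/eqP => [[c Tc [el]]|e].
  have [_ e1 e2] := hs c; move: Tc; rewrite ffunE => Tc.
  have ek : colc c + s c = l by lia.
  rewrite Tc ek in e1 e2.
  by move: e1 e2; case: (tileP _ _ _ _ cr hk hl) => //; lia.
have [i [j [hij he ek el]]] := blank_has_entry k l hk hl e.
have [c [c1 c2]] := cell_exists _ _ _ hij; rewrite -c1 -c2 in he.
have es := has_entry_uniq _ _ _ _ (hs c) he.
exists c; first by rewrite ffunE es c1 -ek.
rewrite /entry_pos c1 c2; congr pair; lia.
Qed.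

End RankToTableau.

Lemma mem_tile_positions n t r k l : ((k, l) \in tile_positions t (corner_mx
  n r)) =
  [&& k < n, l < n & tile_at r k l == t].
Proof.
apply/imfsetP/and3P => [[[i j] /= + [-> ->]]|[hk hl e]].
  by rewrite unfold_in /= mxE => e; split.
by exists (Ordinal hk, Ordinal hl) => //; rewrite unfold_in /= mxE.
Qed.

Lemma mem_tableau_positions mu (T : tableau mu) p :
  reflect (exists c, p = entry_pos c (T c)) (p \in tableau_positions T).
Proof.
apply: (iffP idP) => [/imfsetP[c _ ->]|[c ->]]; first by exists c.
by apply/imfsetP; exists c.
Qed.

(** * Up elbows and set-valued tableaux *)

Section Addable.
Variables (n : nat) (v : 'S_n).
Hypothesis v_vex : vexillary v.
Let L := in_Ylambda v.
Let mu_part := mu_of_partition n v.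

Lemma corner_mx_eq r r' : (forall p q, p <= n -> q <= n -> r p q = r' p q) ->
  corner_mx n r = corner_mx n r'.
Proof.
move=> e; apply/matrixP=> i j; rewrite !mxE /tile_at.
by rewrite !e //; apply: ltnW.
Qed.

Lemma good_rank_blanks r r' : good_rank n v r -> good_rank n v r' ->
  blanks (corner_mx n r) = blanks (corner_mx n r') ->
  forall p q, p <= n -> q <= n -> r p q = r' p q.
Proof.
move=> gr gr' /fsetP e; apply: (good_rank_unique n v) => // k l Lkl.
by have := e (k, l); rewrite !mem_tile_positions;
  have /andP[-> ->] := in_Ylambda_lt _ _ _ _ Lkl.
Qed.

Section OneTableau.
Variable T : tableau (mu_of v).
Hypothesis T_fss : FSYT v T.
Let T_ss : semistandard T := T_fss.1.
Let rT := tableau_rank (mu_of v) T.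
Let P := corner_mx n (glued_rank n v T).

Lemma glued_blanks : blanks P = tableau_positions T.
Proof.
apply/fsetP => [[k l]]; rewrite mem_tile_positions.
apply/and3P/mem_tableau_positions => [[hk hl]|[c [ek el]]].
  by move/(glued_blankP n v v_vex T T_fss k l hk hl) => [c Tc e]; exists c;
    rewrite Tc e.
have Lkl : L k l.
  rewrite ek el; apply: (entry_Ylambda n v v_vex T T_fss) => //.
  exact: (row_leq_entry _ T mu_part T_ss).
have /andP[hk hl] := in_Ylambda_lt _ _ _ _ Lkl; split=> //.
by apply/(glued_blankP n v v_vex T T_fss k l hk hl); exists c;
  rewrite // /entry_pos el ek.
Qed.

Lemma glued_Pipes : Pipes v P.
Proof. by apply/(PipesP n v v_vex); exists (glued_rank n v T) => //;
  apply: glued_rank_good. Qed.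

Lemma glued_unique P' : Pipes v P' -> blanks P' = tableau_positions T -> P' = P.
Proof.
move=> /(PipesP n v v_vex)[r gr ->]; rewrite -glued_blanks => e.
by apply: corner_mx_eq; apply: good_rank_blanks => //; apply: glued_rank_good.
Qed.

Lemma gammaE : gamma v T = P.
Proof.
have [g1 g2] : gamma_graph v T (gamma v T).
  by apply: xgetPex; exists P; split; [exact: glued_Pipes | exact:
    glued_blanks].
exact: glued_unique.
Qed.

(** A position determines only the diagonal of its cell; the rank at the blank determines the
    row. *)
Lemma entry_rank c k l : entry_pos c (T c) = (k, l) -> rT k l + rowc c = T c.
Proof.
case=> <- <-; have hr : rowc c <= T c by apply: (row_leq_entry _ T mu_part
  T_ss).
have g k := leq_tableau_rank _ T mu_part T_ss (T c) (T c + colc c - rowc c) k.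
have := tableau_rank_le _ T (T c) (T c + colc c - rowc c);
  rewrite leq_min -/rT => /andP[h1 h2].
apply/eqP; rewrite eqn_leq; apply/andP; split; last first.
  suff : T c - rowc c <= rT (T c) (T c + colc c - rowc c) by lia.
  rewrite /rT g; [|lia|lia].
  have -> : T c - (T c - rowc c) = rowc c by lia.
  have -> : T c + colc c - rowc c - (T c - rowc c) = colc c by lia.
  by rewrite entry_geE.
have e : (T c).+1 + colc c - rowc c = (T c + colc c - rowc c).+1 by lia.
rewrite leqNgt; apply/negP => lt.
have := leq_tableau_rank _ T mu_part T_ss (T c).+1 (T c + colc c - rowc c).+1
  (T c - rowc c).+1.
rewrite !subSS; have -> : T c - (T c - rowc c) = rowc c by lia.
have -> : T c + colc c - rowc c - (T c - rowc c) = colc c by lia.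
rewrite entry_geE ltnn => H.
have {H} : (T c - rowc c < tableau_rank (mu_of v) T (T c).+1 (T c + colc c -
  rowc c).+1) = false.
  by apply: H; lia.
have := tableau_rank_right _ T mu_part T_ss (T c) (T c + colc c - rowc c).
have := tableau_rank_down _ T mu_part T_ss (T c) (T c + colc c - rowc c).+1.
by rewrite -/rT; lia.
Qed.

(** The last conjunct replaces the flag: in the last cell of a row the two agree by [leq_flag_of],
    and elsewhere the entry to the right bounds [k]. *)
Definition addable (c : young (mu_of v)) k : bool :=
  [&& T c < k, entry_ge T (rowc c) (colc c).+1 k,
      entry_ge T (rowc c).+1 (colc c) k.+1 &
      in_Ylambda v k (k + colc c - rowc c)].

(** With suitable shifts, the four vertices of the tile test [c], its right, lower and diagonal
    neighbours; [T c < k] gives the upper bounds on the rank, the neighbours the lower bounds. *)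
Lemma addable_rank c k l : addable c k -> entry_pos c k = (k, l) ->
  (rT k l + rowc c).+1 = k /\ tile_at (glued_rank n v T) k l = UpElbow.
Proof.
move=> /and4P[lt_Tk ger ged Lk] [el]; rewrite el in Lk.
rewrite glued_tile //.
have hr : rowc c <= T c by apply: (row_leq_entry _ T mu_part T_ss).
have g p q := leq_tableau_rank _ T mu_part T_ss p q.
have ge1 : k - (rowc c).+1 <= rT k l.
  rewrite /rT g; [|lia|lia].
  have -> : k - (k - (rowc c).+1) = (rowc c).+1 by lia.
  have -> : l - (k - (rowc c).+1) = (colc c).+1 by lia.
  apply: (entry_ge_anti _ _ _ _ _ _ (leqnSn k)).
  exact: entry_ge_down.
have lt1 : rT k l < k - rowc c.
  rewrite ltnNge /rT g; [|lia|lia].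
  have -> : k - (k - rowc c) = rowc c by lia.
  have -> : l - (k - rowc c) = colc c by lia.
  by rewrite entry_geE -ltnNge.
have ge2 : k - rowc c <= rT k l.+1.
  rewrite /rT g; [|lia|lia].
  have -> : k - (k - rowc c) = rowc c by lia.
  by have -> : l.+1 - (k - rowc c) = (colc c).+1 by lia.
have ge3 : k - rowc c <= rT k.+1 l.
  rewrite /rT g; [|lia|lia].
  have -> : k.+1 - (k - rowc c) = (rowc c).+1 by lia.
  by have -> : l - (k - rowc c) = colc c by lia.
have lt2 : rT k.+1 l.+1 < (k - rowc c).+1.
  rewrite ltnNge /rT g; [|lia|lia].
  have -> : k.+1 - (k - rowc c).+1 = rowc c by lia.
  have -> : l.+1 - (k - rowc c).+1 = colc c by lia.
  by rewrite entry_geE -ltnNge ltnS ltnW.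
by split; last (apply/eqP; rewrite tile_upE -/rT); lia.
Qed.

Lemma up_elbow_addable k l : (k, l) \in up_elbows P ->
  exists2 c, addable c k & entry_pos c k = (k, l).
Proof.
rewrite mem_tile_positions => /and3P[hk hl /eqP e].
have Lkl := good_up_Ylambda n v _ k l (glued_rank_good n v v_vex T T_fss) hk
  hl e.
move/eqP: e; rewrite glued_tile // tile_upE -/rT => /and3P[h1 h2 h3].
have := tableau_rank_le _ T k l.+1; have := tableau_rank_le _ T k.+1 l.
rewrite !leq_min -/rT => /andP[_ le_l] /andP[le_k _].
have hk' := leq_trans h1 le_k; have hl' := leq_trans h2 le_l.
have g p q := leq_tableau_rank _ T mu_part T_ss p q (rT k l).+1.
have g1 := g k l hk' hl'; rewrite -/rT ltnn in g1.
have g2 := g k l.+1 hk' (leqW hl'); rewrite -/rT h1 subSn // in g2.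
have g3 := g k.+1 l (leqW hk') hl'; rewrite -/rT h2 subSn // in g3.
have [c [c1 c2]] : exists c : young (mu_of v),
    rowc c = k - (rT k l).+1 /\ colc c = l - (rT k l).+1.
  by apply: cell_exists; rewrite ltnNge; apply/negP =>
    /entry_ge_out-/(_ T k); rewrite -g1.
have el : k + colc c - rowc c = l by lia.
exists c; last by rewrite /entry_pos el.
rewrite -c1 -c2 entry_geE in g1.
by rewrite /addable ltnNge -g1 c1 c2 -g2 -g3 /= -c1 -c2 el.
Qed.

End OneTableau.

Lemma entry_pos_inj (c d : young (mu_of v)) k : rowc c <= k -> rowc c = rowc
  d ->
  entry_pos c k = entry_pos d k -> c = d.
Proof. by move=> hk e [h]; apply: cell_inj => //; lia. Qed.

(** Equal grids have equal blanks, hence equal ranks. A common blank then belongs to the same row in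
    both tableaux by [entry_rank], and so to the same cell. *)
Lemma gamma_inj T T' : FSYT v T -> FSYT v T' -> gamma v T = gamma v T' -> T =
  T'.
Proof.
move=> fss fss'; rewrite !gammaE // => e; apply/ffunP => c.
have eT : tableau_positions T = tableau_positions T' by rewrite
  -!glued_blanks // e.
have : entry_pos c (T c) \in tableau_positions T' by rewrite -eT;
  apply/mem_tableau_positions; exists c.
case/mem_tableau_positions => d epos.
have eg := good_rank_blanks _ _ (glued_rank_good n v v_vex T fss)
  (glued_rank_good n v v_vex T' fss') (congr1 (@blanks n) e).
have r1 := entry_rank T fss c _ _ erefl; have r2 := entry_rank T' fss' d _ _
  (esym epos).
have ek : T c = T' d by case: epos.
have hr : rowc c <= T c by apply: (row_leq_entry _ T mu_part fss.1).
have Lc : L (T c) (T c + colc c - rowc c) by apply: (entry_Ylambda n v v_vex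
  T fss).

have rr : tableau_rank (mu_of v) T (T c) (T c + colc c - rowc c) =
  tableau_rank (mu_of v) T' (T c) (T c + colc c - rowc c).
  have /andP[h1 h2] := in_Ylambda_lt _ _ _ _ Lc.
  by have := eg _ _ (ltnW h1) (ltnW h2); rewrite /glued_rank -!/(L _ _) Lc.
have erow : rowc c = rowc d by lia.
rewrite -ek in epos.
by rewrite ek (entry_pos_inj c d (T c)).
Qed.

End Addable.

Lemma fset_min_in (A : {fset nat}) : A != fset0%fset -> fset_min A \in A.
Proof.
case/fset0Pn => x; rewrite -(mem_sort leq) /fset_min => hx.
by rewrite -(mem_sort leq); case: (sort leq A) hx => // a s _; rewrite mem_head.
Qed.

Lemma fset_min_le (A : {fset nat}) k : k \in A -> fset_min A <= k.
Proof.
rewrite -(mem_sort leq) /fset_min.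
have : sorted leq (sort leq A) by apply: sort_sorted; apply: leq_total.
case: (sort leq A) => // a s /= /(order_path_min leq_trans)/allP h.
by rewrite inE => /predU1P[->|/h].
Qed.

Lemma fset_min_eq (A : {fset nat}) a :
  a \in A -> (forall k, k \in A -> a <= k) -> fset_min A = a.
Proof.
move=> aA le_a; apply/eqP; rewrite eqn_leq fset_min_le // le_a // fset_min_in
  //.
by apply/fset0Pn; exists a.
Qed.

Lemma mem_marks mu (TT : set_tableau mu) p : reflect
  (exists c k, [/\ k \in TT c, k != fset_min (TT c) & p = entry_pos c k]) (p
    \in marks TT).
Proof.
apply: (iffP idP) => [/imfset2P[c _ [k + ->]]|[c [k [h1 h2 ->]]]].
  by rewrite !inE => /andP[h1 h2]; exists c, k.
by apply/imfset2P; exists c => //; exists k; rewrite // !inE h1 h2.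
Qed.

Section SetValued.
Variables (n : nat) (v : 'S_n).
Hypothesis v_vex : vexillary v.
Let mu_part := mu_of_partition n v.
Implicit Types (TT : set_tableau (mu_of v)) (c d : young (mu_of v)).

Lemma set_semistandard_pair mu (TT : set_tableau mu) (c d : young mu) k k' :
  set_semistandard TT -> k \in TT c -> k' \in TT d ->
  (rowc c = rowc d -> colc c < colc d -> k <= k') /\
  (colc c = colc d -> rowc c < rowc d -> k < k').
Proof.
move=> [ne sel] hk hk'.
pose T : tableau mu := [ffun e => if e == c then k else if e == d then k'
  else fset_min (TT e)].
have [row col] : semistandard T.
  by apply: sel => e; rewrite ffunE; case: eqP => [->|_] //;
    case: eqP => [->|_] //; apply: fset_min_in.
have Tc : T c = k by rewrite ffunE eqxx.
split=> h1 h2.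
  have Td : T d = k' by rewrite ffunE eqxx; case: eqP => // e;
    rewrite e ltnn in h2.
  by rewrite -Tc -Td; apply: row => //; apply: ltnW.
have Td : T d = k' by rewrite ffunE eqxx; case: eqP => // e;
  rewrite e ltnn in h2.
by rewrite -Tc -Td; apply: col.
Qed.

Lemma set_FSYT_addable TT : set_FSYT v TT ->
  [/\ FSYT v (flatten_tableau TT), forall c, TT c != fset0%fset &
      forall c k, k \in TT c -> k != fset_min (TT c) ->
        addable n v (flatten_tableau TT) c k].
Proof.
move=> [ss fl]; have [ne sel] := ss.
have fss : FSYT v (flatten_tableau TT).
  split; first by apply: sel => c; rewrite ffunE fset_min_in.
  by move=> c; rewrite ffunE; apply: fl; rewrite fset_min_in.
split=> // c k hk nek; have lt_k : fset_min (TT c) < k by rewrite ltn_neqAle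
  eq_sym nek fset_min_le.
rewrite /addable ffunE lt_k /=; apply/and3P; split.
- apply/entry_geP => d e1 e2; rewrite ffunE.
  have [+ _] := set_semistandard_pair _ TT c d k _ ss hk (fset_min_in _ (ne d)).
  by apply; lia.
- apply/entry_geP => d e1 e2; rewrite ffunE.
  have [_] := set_semistandard_pair _ TT c d k _ ss hk (fset_min_in _ (ne d)).
  by apply; lia.
have := cell_in _ c; case e : (nth 0 _ (rowc c)) => [//|j] hj.
have hr : rowc c <= k.
  apply: leq_trans (ltnW lt_k).
  by have := row_leq_entry _ _ mu_part fss.1 c; rewrite ffunE.
have := fl c k hk; rewrite (leq_flag_of n v v_vex _ _ k e hr) => Lk.
by apply: in_Ylambda_le Lk _ _; lia.
Qed.

(** Addability compares an entry with the minima of the right and lower neighbours only;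
    semistandardness of the flattening carries the bound on to the farther cells. *)
Lemma addable_set_FSYT TT : FSYT v (flatten_tableau TT) ->
  (forall c, TT c != fset0%fset) ->
  (forall c k, k \in TT c -> k != fset_min (TT c) ->
        addable n v (flatten_tableau TT) c k) -> set_FSYT v TT.
Proof.
set T := flatten_tableau TT => fss ne add; have ss : semistandard T := fss.1.
have minE c : T c = fset_min (TT c) by rewrite ffunE.
have next c k : k \in TT c -> entry_ge T (rowc c) (colc c).+1 k /\
    entry_ge T (rowc c).+1 (colc c) k.+1.
  move=> hk; have [e|nek] := eqVneq k (fset_min (TT c)).
    have ge : entry_ge T (rowc c) (colc c) k by rewrite entry_geE minE e.
    by split; [apply: entry_ge_right | apply: entry_ge_down].
  by case/and4P: (add c k hk nek).
split.
  split=> // T' hT'; split=> c d h1 h2.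
    have [e|ne_col] := eqVneq (colc c) (colc d);
      first by rewrite (cell_inj _ c d).
    have [/entry_geP h _] := next c (T' c) (hT' c).
    have [d' [d1 d2]] : exists d' : young (mu_of v), rowc d' = rowc c /\ colc
      d' = (colc c).+1.
      by apply: cell_exists; apply: mu_part (cell_in _ d) _ _; lia.
    apply: leq_trans (h d' d1 d2) _; have [row _] := ss.
    apply: leq_trans (row d' d _ _) _; [lia|lia|].
    by rewrite minE fset_min_le.
  have [_ /entry_geP h] := next c (T' c) (hT' c).
  have [d' [d1 d2]] : exists d' : young (mu_of v), rowc d' = (rowc c).+1 /\
    colc d' = colc c.
    by apply: cell_exists; apply: mu_part (cell_in _ d) _ _; lia.
  apply: leq_trans (h d' d1 d2) _; have [_ col] := ss.
  apply: (@leq_trans (T d)); last by rewrite minE fset_min_le.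
  have [e|ne_row] := eqVneq (rowc d') (rowc d);
    first by rewrite (cell_inj _ d' d) //; lia.
  by apply/ltnW/col; lia.
move=> c k hk; have [e|nek] := eqVneq k (fset_min (TT c)).
  by have [_ fl] := fss; rewrite e -minE; apply: fl.
have /and4P[lt_k /entry_geP ger _ Lk] := add c k hk nek.
have := cell_in _ c; case e : (nth 0 _ (rowc c)) => [//|j] hj.
have hr : rowc c <= k.
  by apply: leq_trans (ltnW lt_k); apply: (row_leq_entry _ T mu_part ss).
have [ej|ne_j] := eqVneq (colc c) j.
  by rewrite (leq_flag_of n v v_vex _ _ k e hr) -ej.
have [d [d1 d2]] : exists d : young (mu_of v), rowc d = rowc c /\ colc d =
  (colc c).+1.
  by apply: cell_exists; rewrite e; lia.
by apply: leq_trans (ger d d1 d2) _; have [_ fl] := fss; rewrite -d1; apply: fl.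
Qed.

Lemma addable_inj T c d k : FSYT v T -> addable n v T c k -> addable n v T d
  k ->
  entry_pos c k = entry_pos d k -> c = d.
Proof.
move=> fss ac ad e.
have [e1 _] := addable_rank n v v_vex T fss c k _ ac erefl.
have [e2 _] := addable_rank n v v_vex T fss d k _ ad (esym e).
by apply: (entry_pos_inj n v c d k) => //; lia.
Qed.

Lemma entry_not_addable T c d k : FSYT v T -> T c = k -> addable n v T d k ->
  entry_pos c k != entry_pos d k.
Proof.
move=> fss Tc ad; apply/eqP => e.
have [_ up] := addable_rank n v v_vex T fss d k _ ad (esym e).
have : entry_pos c k \in blanks (corner_mx n (glued_rank n v T)).
  by rewrite glued_blanks //; apply/mem_tableau_positions; exists c; rewrite Tc.
by rewrite mem_tile_positions up => /and3P[].
Qed.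

Lemma marks_up_elbows TT : set_FSYT v TT ->
  (marks TT `<=` up_elbows (gamma v (flatten_tableau TT)))%fset.
Proof.
move=> /set_FSYT_addable[fss ne add]; rewrite (gammaE n v) //.
apply/fsubsetP => p /mem_marks[c [k [hk nek ->]]].
have ac := add c k hk nek; have [_ up] := addable_rank n v v_vex _ fss c k _
  ac erefl.
rewrite mem_tile_positions up eqxx.
by have /and4P[_ _ _ /in_Ylambda_lt/andP[-> ->]] := ac.
Qed.

Lemma gamma_bar_inj TT TT' : set_FSYT v TT -> set_FSYT v TT' ->
  gamma_bar v TT = gamma_bar v TT' -> TT = TT'.
Proof.
move=> /set_FSYT_addable[fss ne add] /set_FSYT_addable[fss' ne' add'] [eg em].
have eT := gamma_inj n v v_vex _ _ fss fss' eg.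
have min_eq c : fset_min (TT c) = fset_min (TT' c).
  by have := congr1 (fun T : tableau _ => T c) eT; rewrite !ffunE.
apply/ffunP => c; apply/fsetP => k.
have [ek|nek] := eqVneq k (fset_min (TT c)).
  have h1 := fset_min_in _ (ne c); have h2 := fset_min_in _ (ne' c).
  by rewrite ek h1 min_eq h2.
have nek' : k != fset_min (TT' c) by rewrite -min_eq.
apply/idP/idP => hk.
  have /mem_marks[d [k' [hk' nd e]]] : entry_pos c k \in marks TT'.
    by rewrite -em; apply/mem_marks; exists c, k.
  have ek : k = k' by case: e.
  rewrite -{k'}ek in hk' nd e.
  rewrite (addable_inj (flatten_tableau TT) c d k fss) //; first exact: add.
  by rewrite eT; apply: add'.
have /mem_marks[d [k' [hk' nd e]]] : entry_pos c k \in marks TT.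
  by rewrite em; apply/mem_marks; exists c, k.
have ek : k = k' by case: e.
rewrite -{k'}ek in hk' nd e.
rewrite (addable_inj (flatten_tableau TT) c d k fss) //; last exact: add.
by rewrite eT; apply: add'.
Qed.

Lemma gamma_bar_surj P S : MPipes v (P, S) ->
  exists2 TT, set_FSYT v TT & gamma_bar v TT = (P, S).
Proof.
rewrite /MPipes /= => -[/(PipesP n v v_vex)[r gr ->] /fsubsetP sub].
have [T [fss eT]] := good_rank_tableau n v v_vex r gr.
have eP := corner_mx_eq n _ _ eT.
rewrite -eP in sub.
(* The range [iota 0 n] loses nothing, since an addable entry is a row index of lambda. *)
pose TT : set_tableau (mu_of v) := [ffun c =>
  T c |` [fset k in iota 0 n | (entry_pos c k \in S) && addable n v T c
    k]]%fset.
have TTE c k : (k \in TT c) = (k == T c) || [&& k < n, entry_pos c k \in S &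
  addable n v T c k].
  by rewrite ffunE !inE /= mem_iota add0n.
have minE c : fset_min (TT c) = T c.
  apply: fset_min_eq => [|k]; rewrite TTE ?eqxx //.
  by case/predU1P=> [->//|/and3P[_ _ /and4P[/ltnW]]].
have flatE : flatten_tableau TT = T by apply/ffunP => c; rewrite ffunE.
exists TT.
  apply: addable_set_FSYT; rewrite ?flatE //.
    by move=> c; apply/fset0Pn; exists (T c); rewrite TTE eqxx.
  move=> c k; rewrite TTE minE => /predU1P[->|/and3P[]//]; by rewrite eqxx.
rewrite /gamma_bar flatE (gammaE n v) // eP; suff -> : marks TT = S by [].
apply/fsetP => [[k l]]; apply/mem_marks/idP => [[c [k' []]]|hS].
  by rewrite TTE minE => /predU1P[->|/and3P[_ + _] _ ->//]; rewrite eqxx.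
have [c ac e] := up_elbow_addable n v v_vex T fss k l (sub _ hS).
exists c, k; rewrite TTE minE e hS ac /= !andbT;
  have /and4P[lt _ _ /in_Ylambda_lt/andP[-> _]] := ac.
by rewrite orbT gtn_eqF.
Qed.

(** * Comparison of weights *)

Lemma coxeter_lengthE : coxeter_length v = #|` young (mu_of v)|.
Proof.
rewrite /young card_fseq undup_id; last first.
  apply: allpairs_uniq_dep => [|i _|]; rewrite ?iota_uniq //.
  by move=> [a b] [c d] _ _ /= [-> ->].
rewrite size_allpairs_dep.
have -> : [seq size (iota 0 (nth 0 (mu_of v) i)) | i <- iota 0 (size (mu_of
  v))] = mu_of v.
  by rewrite -[RHS](mkseq_nth 0); apply: eq_map => i; rewrite size_iota.
rewrite /mu_of (perm_sumn (permEl (perm_sort _ _))) sumnE big_map big_enum /=.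
rewrite /coxeter_length -sum1_card.
rewrite (eq_bigl (fun p : 'I_n * 'I_n => (p.1 < p.2) && (v p.2 < v p.1)));
  last by move=> p; rewrite inE.
rewrite -(pair_big_dep xpredT (fun i j : 'I_n => (i < j) && (v j < v i)) (fun
  _ _ => 1)) /=.
apply: eq_bigr => i _; rewrite sum1_card /lehmer.
(* The inversion at positions [i < j] corresponds to the Rothe cell [(i, v j)]. *)
rewrite -(card_imset _ (@perm_inj _ v)); apply: eq_card => j.
apply/imsetP/idP => [[j' + ->]|].
  by rewrite !inE permK andbC.
by rewrite !inE /= => /andP[h1 h2]; exists (v^-1 j)%g;
  rewrite ?permKV // unfold_in permKV h1 h2.
Qed.

(** Distinct entries occupy distinct positions: minima sit at blanks and other entries at up elbows,
    and within either kind the rank at the tile recovers the cell. *)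
Lemma weight_positions TT : set_FSYT v TT ->
  perm_eq (blanks (gamma v (flatten_tableau TT)) `|` marks TT)%fset
          [seq entry_pos c k | c <- enum {: young (mu_of v)}, k <- (TT c :
            seq nat)].
Proof.
move=> fTT; have [fss ne add] := set_FSYT_addable _ fTT.
rewrite (gammaE n v) // glued_blanks //; apply: uniq_perm;
  first exact: fset_uniq.
  apply: allpairs_uniq_dep => [|c _|]; rewrite ?enum_uniq ?fset_uniq //.
  move=> [c k] [d k'] /allpairsPdep[c1 [k1 [_ h1 e1]]] /allpairsPdep[d1 [k2
    [_ h2 e2]]] /= e.
  case: (congr1 (fun z : {_ & nat} => (tag z, tagged z)) e1) => /= e3 e4.
  case: (congr1 (fun z : {_ & nat} => (tag z, tagged z)) e2) => /= e5 e6.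
  rewrite -e3 -e4 in h1; rewrite -e5 -e6 in h2; move=> {e1 e2 e3 e4 e5 e6}.
  have ek : k = k' by case: e.
  rewrite -{k'}ek in h2 e *; suff -> : c = d by [].
  have [mc|nmc] := eqVneq k (fset_min (TT c)); have [md|nmd] := eqVneq k
    (fset_min (TT d)).
  - have Tc : flatten_tableau TT c = k by rewrite ffunE.
    have Td : flatten_tableau TT d = k by rewrite ffunE.
    have := entry_rank n v _ fss c k _ (congr1 (entry_pos c) Tc).
    have := entry_rank n v _ fss d k _ (etrans (congr1 (entry_pos d) Td)
      (esym e)).
    by move=> r1 r2; apply: (entry_pos_inj n v c d k) => //; lia.
  - have := entry_not_addable _ c d k fss _ (add d k h2 nmd).
    by rewrite ffunE e eqxx; move=> /(_ (esym mc)).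
  - have := entry_not_addable _ d c k fss _ (add c k h1 nmc).
    by rewrite ffunE e eqxx; move=> /(_ (esym md)).
  - exact: addable_inj fss (add c k h1 nmc) (add d k h2 nmd) e.
move=> p; rewrite inE; apply/orP/allpairsPdep.
  case=> [/mem_tableau_positions[c ->]|/mem_marks[c [k [h1 h2 ->]]]].
    by exists c, (flatten_tableau TT c); rewrite mem_enum ffunE fset_min_in.
  by exists c, k; rewrite mem_enum.
case=> c [k [_ hk ->]]; have [e|nek] := eqVneq k (fset_min (TT c)).
  by left; apply/mem_tableau_positions; exists c; rewrite ffunE e.
by right; apply/mem_marks; exists c, k.
Qed.

Lemma blanks_marks_disjoint TT : set_FSYT v TT ->
  [disjoint blanks (gamma v (flatten_tableau TT)) & marks TT]%fset.
Proof.
move=> fTT; apply/fdisjointP => [[k l]] hb; apply/negP => hm.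
have /fsubsetP/(_ _ hm) := marks_up_elbows _ fTT; move: hb.
have [fss _ _] := set_FSYT_addable _ fTT; rewrite (gammaE n v) //
  !mem_tile_positions.
by move=> /and3P[_ _ /eqP->] /and3P[].
Qed.

End SetValued.

Lemma gamma_bar_weight n (v : 'S_n) (v_vex : vexillary v) (R : comNzRingType)
  (beta : R)
    (x y : nat -> R) (TT : set_tableau (mu_of v)) : set_FSYT v TT ->
  marked_bpd_weight beta x y v (gamma_bar v TT) = tableau_weight beta x y TT.
Proof.
move=> fTT; have pe := weight_positions n v v_vex TT fTT.
rewrite /marked_bpd_weight /tableau_weight /= (perm_big _ pe) /=
  big_allpairs_dep big_enum.
rewrite coxeter_lengthE; congr (_ ^+ _ * _)%R; congr (_ - _).
(* Blanks and marks are disjoint, so their cardinalities add up to the number of entries. *)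
rewrite -cardfsUI.
have /eqP-> : (blanks (gamma v (flatten_tableau TT)) `&` marks TT ==
  fset0)%fset.
  exact: blanks_marks_disjoint.
rewrite cardfs0 addn0 -[LHS]/(size (enum_fset _)) (perm_size pe)
  size_allpairs_dep.
by rewrite sumnE big_map big_enum.
Qed.

(** The first clause shows that on flagged tableaux [gamma] takes the value prescribed by its
    definition and never falls back to the default grid. *)
Theorem theorem1p6 (n : nat) (v : 'S_n) (v_vexillary : vexillary v) :
  [/\ forall T : tableau (mu_of v), FSYT v T ->
        exists! P : 'M[tile]_n, Pipes v P /\ blanks P = tableau_positions T,
      set_bij (set_FSYT v) (MPipes v) (gamma_bar v) &
      forall (R : comNzRingType) (beta : R) (x y : nat -> R)
             (TT : set_tableau (mu_of v)),
        set_FSYT v TT ->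
        marked_bpd_weight beta x y v (gamma_bar v TT) = tableau_weight beta x y TT].
Proof.
split.
- move=> T fss; exists (corner_mx n (glued_rank n v T)); split.
    by split; [apply: glued_Pipes | apply: glued_blanks].
  by move=> P' [h1 h2]; apply/esym/glued_unique.
- split.
  + move=> TT fTT; have [fss _ _] := set_FSYT_addable n v v_vexillary TT fTT.
    split; last exact: marks_up_elbows.
    by rewrite /= (gammaE n v) //; apply: glued_Pipes.
  + by move=> TT TT'; rewrite !in_setE; apply: gamma_bar_inj.
  + by move=> [P S] /(gamma_bar_surj n v v_vexillary)[TT fTT <-]; exists TT.
- by move=> R beta x y TT; apply: gamma_bar_weight.
Qed.
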